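(* Let $\Gamma$ be a countably infinite group, $n\in\mathbb N$, and let $f\in M_n(\mathbb Z\Gamma)$ be positively row lopsided. Let $\nu$ be a probability measure on $S_f$ such that for every $j\in\{1,\dots,n\}$ its marginal distribution on the $j$-th factor $\{0,\dots,|M_j|-1\}$ of $S_f$ is the uniform probability measure. Then the set $$\{y\in S_f^\Gamma : |\phi_f^{-1}(\phi_f(y))\cap S_f^\Gamma|>1\}$$ has $\nu^\Gamma$-measure $0$. Consequently, $\phi_f$ (restricted to $S_f^\Gamma$) is a measure conjugacy between the shift action $\Gamma\curvearrowright(S_f^\Gamma,\nu^\Gamma)$ and $\Gamma\curvearrowright (X_f,(\phi_f)_*\nu^\Gamma)$, i.e. it is a $\Gamma$-equivariant measurable map which is injective on a $\Gamma$-invariant $\nu^\Gamma$-conull set.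
   Context: $\mathbb Z\Gamma$ is the integral group ring: finitely supported $f:\Gamma\to\mathbb Z$, written $f=\sum_s f_s s$, with product $(fg)_t=\sum_{s}f_{ts^{-1}}g_s$ and involution $(f^* )_s=f_{s^{-1}}$; $\mathrm{supp}(f)=\{s:f_s\neq0\}$. $\ell^1_{\mathbb R}(\Gamma)$, $\ell^\infty_{\mathbb R}(\Gamma)$ are the absolutely summable/bounded real functions on $\Gamma$, with the same convolution formula for products. For $f=(f^{(km)})_{k,m\in[n]}\in M_n(\ell^1_{\mathbb R}(\Gamma))$, $(f^* )^{(km)}=(f^{(mk)})^*$, and $\|f\|_{1,\infty}=\max_m\sum_k\|f^{(km)}\|_1$. Elements $x$ of $((\mathbb R/\mathbb Z)^\Gamma)^n$, of $(\ell^\infty_{\mathbb R}(\Gamma))^n$ or of $(\mathbb Z\Gamma)^n$ are regarded as row vectors $x=(x_1,\dots,x_n)$ with entries $x_{s,k}=(x_k)_s$, and for a matrix $F$ over $\mathbb Z\Gamma$ or $\ell^1_{\mathbb R}(\Gamma)$, $(xF)_m=\sum_k x_kF^{(km)}$ with the convolution above. $X_f=\{x\in((\mathbb R/\mathbb Z)^\Gamma)^n: xf^*=0\}$ (the Pontryagin dual of $(\mathbb Z\Gamma)^n/(\mathbb Z\Gamma)^nf$), a compact abelian group with $\Gamma$ acting by the left shift $(sx)_{t,k}=x_{s^{-1}t,k}$; $\mu_{X_f}$ is its normalized Haar measure. When $f$ is invertible in $M_n(\ell^1_{\mathbb R}(\Gamma))$, the map $\phi_f$ is defined on $(\mathbb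 Z^n)^\Gamma\cap(\ell^\infty_{\mathbb R}(\Gamma))^n$ by $\phi_f(y)=\pi(y(f^* )^{-1})$, where $\pi:(\mathbb R^\Gamma)^n\to((\mathbb R/\mathbb Z)^\Gamma)^n$ is the quotient map; its values lie in $X_f$ and its restriction to $S^\Gamma$ for finite $S\subseteq\mathbb Z^n$ is continuous and $\Gamma$-equivariant (shift action $(sy)_t=y_{s^{-1}t}$). Row/column lopsided: $f\in M_n(\mathbb Z\Gamma)$ is row lopsided if $f=M-g$ with $M,g\in M_n(\mathbb Z\Gamma)$, $\mathrm{supp}(M)\cap\mathrm{supp}(g)=\emptyset$ (supports as subsets of $\Gamma\times[n]^2$), $M=\mathrm{diag}(M_1s_1,\dots,M_ns_n)$ with $s_k\in\Gamma$, $M_k\in\mathbb Z$, and $|M_k|>\sum_{m\in[n]}\|g^{(km)}\|_1$ for each $k$; column lopsided if instead $|M_k|>\sum_{m}\|g^{(mk)}\|_1$ for each $k$; lopsided if both. It is positively row (resp. column) lopsided if moreover there is a right-invariant partial order $\le$ on $\Gamma$ ($s\le t\iff s\gamma\le t\gamma$) with $s_m<t$ for all $m\in[n]$ and all $t\in\bigcup_{k}\mathrm{supp}(g^{(km)})$ (equivalently a subsemigroup $P\subseteq\Gamma\setminus\{e_\Gamma\}$ containing $\bigcup_{k,m}\mathrm{supp}(g^{(km)}s_m^{-1})$); positively lopsided if both positively row and positively column lopsided. For such $f$, $S_f=\prod_{k\in[n]}\{0,\dots,|M_k|-1\}\subseteq\mathbb Z^n$. Row or column lopsided matrices are invertible in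 $M_n(\ell^1_{\mathbb R}(\Gamma))$. $\nu^\Gamma$ is the product measure on $S_f^\Gamma$. *)

(* Defs.v *)
From HB Require Import structures.
From mathcomp Require Import all_boot all_order all_algebra.
From mathcomp Require Import all_classical all_reals all_analysis.

Set Implicit Arguments.
Unset Strict Implicit.
Unset Printing Implicit Defensive.
Import Order.TTheory GRing.Theory Num.Theory.
Import numFieldNormedType.Exports.
Local Open Scope classical_set_scope.
Local Open Scope ring_scope.

(*  - An element of M_n(Z Gamma) is f : 'I_n -> 'I_n -> Gamma -> int    *)
(*    (f k m t = coefficient of t in the entry f^{(km)}), with finite   *)
(*    support.  Matrices over l^1_R(Gamma) are 'I_n -> 'I_n -> Gamma->R. *)
(*  - Row vectors x in (R^Gamma)^n are x : Gamma -> 'I_n -> R with      *)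
(*    x t k = x_{t,k}.                                                  *)
(*  - R/Z is represented by the fundamental domain [0,1); the quotient  *)
(*    map pi is the fractional part [frac].                             *)

Section Defs.
Variables (R : realType) (Gamma : groupType) (n : nat).

Definition zsupp (a : Gamma -> int) : set Gamma := [set t | a t != 0].

Definition zl1norm (a : Gamma -> int) : int :=
  (\sum_(t \in zsupp a) `|a t|)%R.

(* sum of an absolutely summable real family over Gamma
   (positive part minus negative part, both as \esum) *)
Definition lsum (a : Gamma -> R) : R :=
  fine (\esum_(t in [set: Gamma]) (Num.max (a t) 0)%:E) -
  fine (\esum_(t in [set: Gamma]) (Num.max (- a t) 0)%:E).

Definition is_l1 (a : Gamma -> R) : Prop :=
  summable [set: Gamma] (fun t => (a t)%:E).

Definition mconv (A B : 'I_n -> 'I_n -> Gamma -> R) : 'I_n -> 'I_n -> Gamma -> R :=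
  fun k m t => \sum_(j < n) lsum (fun s => A k j (t * s^-1)%g * B j m s).

Definition mone : 'I_n -> 'I_n -> Gamma -> R :=
  fun k m t => if (k == m) && (t == 1%g) then 1 else 0.

Definition rvmul (x : Gamma -> 'I_n -> R) (F : 'I_n -> 'I_n -> Gamma -> R) :
  Gamma -> 'I_n -> R :=
  fun t m => \sum_(k < n) lsum (fun s => x (t * s^-1)%g k * F k m s).

Definition zstar (f : 'I_n -> 'I_n -> Gamma -> int) : 'I_n -> 'I_n -> Gamma -> R :=
  fun k m s => (f m k (s^-1)%g)%:~R.

Definition is_l1_inverse (F H : 'I_n -> 'I_n -> Gamma -> R) : Prop :=
  (forall k m, is_l1 (H k m)) /\ mconv F H = mone /\ mconv H F = mone.

(* the inverse in M_n(l^1_R(Gamma)) (chosen classically; it is unique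
   when it exists) *)
Definition l1inv (F : 'I_n -> 'I_n -> Gamma -> R) : 'I_n -> 'I_n -> Gamma -> R :=
  if pselect (exists H, is_l1_inverse F H) is left ex then proj1_sig (cid ex)
  else fun _ _ _ => 0.

(* quotient map R -> R/Z, with R/Z represented by [0,1) *)
Definition frac (r : R) : R := r - (Num.floor r)%:~R.

Definition Xf (f : 'I_n -> 'I_n -> Gamma -> int) : set (Gamma -> 'I_n -> R) :=
  [set x | (forall t k, 0 <= x t k < 1) /\
           (forall t m, frac (rvmul x (zstar f) t m) = 0)].

(* phi_f(y) = pi(y (f^star)^{-1}) for y in (Z^n)^Gamma (here N^n-valued,
   which is all that is needed for S_f^Gamma) *)
Definition phi (f : 'I_n -> 'I_n -> Gamma -> int) (y : Gamma -> 'I_n -> nat) :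
  Gamma -> 'I_n -> R :=
  fun t m => frac (rvmul (fun s k => (y s k)%:R) (l1inv (zstar f)) t m).

Definition gshift (T : Type) (s : Gamma) (x : Gamma -> T) : Gamma -> T :=
  fun t => x (s^-1 * t)%g.

(* f = M - g positively row lopsided, M = diag(Mk_1 sk_1, ..., Mk_n sk_n) *)
Definition pos_row_lopsided (f : 'I_n -> 'I_n -> Gamma -> int)
  (Mk : 'I_n -> int) (sk : 'I_n -> Gamma) (g : 'I_n -> 'I_n -> Gamma -> int) : Prop :=
  [/\ (forall k m, finite_set (zsupp (g k m))),
      (forall k m t, f k m t = (if (k == m) && (t == sk k) then Mk k else 0) - g k m t),
      (* supp(M) and supp(g) disjoint *)
      (forall k, g k k (sk k) = 0),
      (forall k, \sum_(m < n) zl1norm (g k m) < `|Mk k|) &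
      exists le : rel Gamma,
        [/\ reflexive le, antisymmetric le, transitive le,
            (forall s t u, le s t = le (s * u)%g (t * u)%g) &
            (forall k m t, g k m t != 0 -> le (sk m) t /\ sk m != t)]].

Definition Sf (Mk : 'I_n -> int) := {dffun forall k : 'I_n, 'I_(absz (Mk k))}.

Definition Sf_emb (Mk : 'I_n -> int) (s : Sf Mk) : 'I_n -> nat :=
  fun k => nat_of_ord (s k).

Definition SfG (Mk : 'I_n -> int) : set (Gamma -> 'I_n -> nat) :=
  [set y | forall t k, (y t k < absz (Mk k))%N].

Definition cylinders : set (set (Gamma -> 'I_n -> nat)) :=
  [set [set y | y t = v] | t in [set: Gamma] & v in [set: 'I_n -> nat]].

End Defs.

Notation Omega Gamma n := (g_sigma_algebraType (@cylinders Gamma n)).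

(* P is the product measure nu^Gamma (nu a probability vector on S_f,
   transported into N^n): it is determined by its values on cylinder sets *)
Definition is_product_measure (R : realType) (Gamma : groupType) (n : nat)
  (Mk : 'I_n -> int) (nu : Sf Mk -> R) (P : set (Omega Gamma n) -> \bar R) : Prop :=
  forall (m : nat) (t : 'I_m -> Gamma) (s : 'I_m -> Sf Mk),
    injective t ->
    P [set y | forall i, y (t i) = Sf_emb (s i)] = (\prod_(i < m) nu (s i))%:E.

(* Main.v *)
Require Import Defs.
From HB Require Import structures.
From mathcomp Require Import all_boot all_order all_algebra finmap.
From mathcomp Require Import all_classical all_reals all_analysis.
From mathcomp Require Import measurable_realfun ring lra zify.
Import Order.TTheory GRing.Theory Num.Theory.
Import numFieldNormedType.Exports.
Local Open Scope classical_set_scope.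
Local Open Scope ring_scope.
Set Implicit Arguments.
Unset Strict Implicit.
Unset Printing Implicit Defensive.

(** If phi_f(y) = phi_f(y') then z := (y - y')(f^star)^{-1} is a bounded integral
    vector with z f^star = y - y'.  Put x_{t,m} = sgn(M_m) z_{t s_m, m}; dividing
    out the diagonal part, this reads
      y_{t,m} + sum_{k,p} a^{(mk)}_p x_{tp,k} = y'_{t,m} + |M_m| x_{t,m}
    with |a^{(mk)}_p| = |g^{(mk)}_{p s_k}| and p in the positive semigroup.  As
    0 <= y'_{t,m} < |M_m|, the integer x_{t,m} is the floor of the left-hand side
    over |M_m|, so iterating this from the trivial bounds +-B bounds x from above
    and below by envelopes that depend on y alone, and only on its coordinates in a
    finite tree growing from t in positive directions.  The digit y_{t,m} is uniform
    and independent of the coordinates at the proper descendants of t, and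
    sum_{0 <= v < N} floor((v + C) / N) = C, so one iteration multiplies the
    expected envelope by at most theta < 1.  Hence for almost every y all envelopes
    eventually vanish, which forces x = 0. *)

(** * Sums of absolutely summable families *)

Section Lsum.
Context (R : realType) (Gamma : groupType).
Implicit Types (a b : Gamma -> R) (T S : seq Gamma).

(** An $\ell^1$ bound stated through finite partial sums, which keeps estimates in [R] rather than
    in the extended reals. *)
Definition l1_bounded a (C : R) :=
  forall T, uniq T -> \sum_(t <- T) `|a t| <= C.

Lemma esum_le_bound a (C : R) :
  (forall T, uniq T -> \sum_(t <- T) a t <= C) ->
  (\esum_(t in [set: Gamma]) (a t)%:E <= C%:E)%E.
Proof.
move=> aC; apply: ub_ereal_sup => _ [A [finA _] <-].
by rewrite fsbig_finite//= sumEFin lee_fin; apply: aC; exact: fset_uniq.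
Qed.

Lemma sum_le_esum a T : uniq T ->
  ((\sum_(t <- T) a t)%:E <= \esum_(t in [set: Gamma]) (a t)%:E)%E.
Proof.
move=> uT; apply: esum_ge; exists [set` T]; first by split; [exact: finite_seq|].
by rewrite -fsbig_seq// sumEFin.
Qed.

Lemma esum_finsupp a S : (forall t, 0 <= a t) -> uniq S ->
  (forall t, t \notin S -> a t = 0) ->
  \esum_(t in [set: Gamma]) (a t)%:E = (\sum_(t <- S) a t)%:E.
Proof.
move=> a0 uS aS; rewrite -sumEFin fsbig_seq//.
rewrite -esum_fset//; last by move=> i _; rewrite lee_fin.
rewrite [RHS]esum_mkcond; apply: eq_esum => t _.
by rewrite mem_setE; case: ifPn => // /aS ->.
Qed.

Lemma l1_bounded_is_l1 a C : l1_bounded a C -> is_l1 a.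
Proof.
move=> aC; rewrite /is_l1 /summable.
by apply: le_lt_trans (ltry C); exact: esum_le_bound.
Qed.

Lemma is_l1_bounded a : is_l1 a -> exists C, l1_bounded a C.
Proof.
rewrite /is_l1 summableE /= => al1.
exists (fine (\esum_(t in [set: Gamma]) `|a t|%:E)) => T uT.
by rewrite -lee_fin fineK//; exact: (@sum_le_esum (fun t => `|a t|)).
Qed.

Lemma l1_bounded_le a b C : (forall t, `|b t| <= `|a t|) ->
  l1_bounded a C -> l1_bounded b C.
Proof. by move=> ba aC T /aC; apply: le_trans; apply: ler_sum. Qed.

Lemma l1_boundedZ (B : R) a C c : 0 <= B -> l1_bounded a C ->
  (forall t, `|c t| <= B) -> l1_bounded (fun t => c t * a t) (B * C).
Proof.
move=> B0 aC cB T uT; apply: le_trans (ler_wpM2l B0 (aC T uT)).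
rewrite mulr_sumr; apply: ler_sum => t _.
by rewrite normrM ler_wpM2r.
Qed.

Lemma lsum_finsupp a S : uniq S -> (forall t, t \notin S -> a t = 0) ->
  lsum a = \sum_(t <- S) a t.
Proof.
move=> uS aS; rewrite /lsum (@esum_finsupp (fun t => Num.max (a t) 0) S)//; last 2 first.
- by move=> t; rewrite le_max lexx orbT.
- by move=> t /aS ->; rewrite maxxx.
rewrite (@esum_finsupp (fun t => Num.max (- a t) 0) S)//=; last 2 first.
- by move=> t; rewrite le_max lexx orbT.
- by move=> t /aS ->; rewrite oppr0 maxxx.
rewrite -sumrB; apply: eq_bigr => t _.
by case: (lerP (a t) 0) => at0; case: (lerP (- a t) 0) => ?; lra.
Qed.

Lemma lsum_reindex (h h' : Gamma -> Gamma) a : cancel h h' -> cancel h' h ->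
  lsum (a \o h) = lsum a.
Proof.
move=> hK h'K; have hb : set_bij [set: Gamma] [set: Gamma] h.
  by split=> [//|x y _ _ e|x _]; [exact: can_inj hK _ _ e|exists (h' x)].
by rewrite /lsum; congr (fine _ - fine _); rewrite [RHS](reindex_esum [set: Gamma] _ h).
Qed.

Lemma lsum_le_bound a C : l1_bounded a C -> `|lsum a| <= C.
Proof.
move=> aC; rewrite /lsum.
have bnd (b : Gamma -> R) : (forall t, 0 <= b t <= `|a t|) ->
    0 <= fine (\esum_(t in [set: Gamma]) (b t)%:E) <= C.
  move=> ba; have b0 : (0 <= \esum_(t in [set: Gamma]) (b t)%:E)%E.
    by apply: esum_ge0 => t _; rewrite lee_fin; case/andP: (ba t).
  rewrite fine_ge0//= -lee_fin.
  have bC : (\esum_(t in [set: Gamma]) (b t)%:E <= C%:E)%E.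
    apply: esum_le_bound => T uT; apply: le_trans (aC T uT).
    by apply: ler_sum => t _; case/andP: (ba t).
  rewrite fineK// ge0_fin_numE//; exact: le_lt_trans bC (ltry C).
have h (u : R) : 0 <= Num.max u 0 <= `|u|.
  by case: (lerP u 0) => u0 /=; rewrite ?lexx ?normr_ge0// ltW//= ler_norm.
have /andP[p0 pC] := bnd (fun t => Num.max (a t) 0) (fun t => h (a t)).
have /andP[q0 qC] : 0 <= fine (\esum_(t in [set: Gamma]) (Num.max (- a t) 0)%:E) <= C.
  by apply: bnd => t; rewrite -normrN.
by rewrite ler_norml; apply/andP; split; lra.
Qed.

(** Any splitting into summable nonnegative parts computes [lsum]; additivity relies on this because
    positive parts do not add up. *)
Lemma lsum_diff p q C D : (forall t, 0 <= p t) -> (forall t, 0 <= q t) ->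
  l1_bounded p C -> l1_bounded q D ->
  lsum (fun t => p t - q t) =
  fine (\esum_(t in [set: Gamma]) (p t)%:E) -
  fine (\esum_(t in [set: Gamma]) (q t)%:E).
Proof.
move=> p0 q0 pC qD.
have fin a E : (forall t, 0 <= a t) -> l1_bounded a E ->
    \esum_(t in [set: Gamma]) (a t)%:E \is a fin_num.
  move=> a0 /l1_bounded_is_l1; rewrite /is_l1 summableE.
  by under eq_esum do rewrite gee0_abs ?lee_fin//.
have := @esumB _ _ [set: Gamma] (EFin \o p) (EFin \o q) (l1_bounded_is_l1 pC)
  (l1_bounded_is_l1 qD) (fun t _ => p0 t) (fun t _ => q0 t).
have pe : (fun t => (((EFin \o p) \- (EFin \o q))^\+ t)%E) =
    (fun t => (Num.max (p t - q t) 0)%:E).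
  by apply/funext => t; rewrite funeposE/= EFin_max EFinB.
have qe : (fun t => (((EFin \o p) \- (EFin \o q))^\- t)%E) =
    (fun t => (Num.max (- (p t - q t)) 0)%:E).
  by apply/funext => t; rewrite funenegE/= EFin_max EFinN EFinB.
rewrite pe qe => e; rewrite /lsum -!fineB ?(fin p C) ?(fin q D)//.
- by rewrite e.
- apply: (fin _ C) => [t|]; first by rewrite le_max lexx orbT.
  apply: l1_bounded_le pC => t; rewrite !ger0_norm// ?le_max ?lexx ?orbT//.
  by have := q0 t; have := p0 t; rewrite ge_max => ? ?; apply/andP; split; lra.
- apply: (fin _ D) => [t|]; first by rewrite le_max lexx orbT.
  apply: l1_bounded_le qD => t; rewrite !ger0_norm// ?le_max ?lexx ?orbT//.
  by have := q0 t; have := p0 t; rewrite ge_max => ? ?; apply/andP; split; lra.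
Qed.

Lemma l1_boundedD a b C D : l1_bounded a C -> l1_bounded b D ->
  l1_bounded (fun t => a t + b t) (C + D).
Proof.
move=> aC bD T uT; apply: le_trans (lerD (aC T uT) (bD T uT)).
by rewrite -big_split; apply: ler_sum => t _; exact: ler_normD.
Qed.

Lemma lsumD a b C D : l1_bounded a C -> l1_bounded b D ->
  lsum (fun t => a t + b t) = lsum a + lsum b.
Proof.
move=> aC bD.
pose pp (u : R) := Num.max u 0; pose nn (u : R) := Num.max (- u) 0.
have ppn u : u = pp u - nn u.
  by rewrite /pp /nn; case: (lerP u 0) => u0; case: (lerP (- u) 0) => ?; lra.
have pp0 u : 0 <= pp u by rewrite le_max lexx orbT.
have nn0 u : 0 <= nn u by rewrite le_max lexx orbT.
have ppC c E : l1_bounded c E -> l1_bounded (pp \o c) E.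
  apply: l1_bounded_le => t /=; rewrite ger0_norm// /pp.
  by case: (lerP (c t) 0) => // _; exact: ler_norm.
have nnC c E : l1_bounded c E -> l1_bounded (nn \o c) E.
  apply: l1_bounded_le => t /=; rewrite ger0_norm// /nn.
  by case: (lerP (- c t) 0) => // _; rewrite -normrN; exact: ler_norm.
have fin c E : (forall t, 0 <= c t) -> l1_bounded c E ->
    \esum_(t in [set: Gamma]) (c t)%:E \is a fin_num.
  move=> c0 /l1_bounded_is_l1; rewrite /is_l1 summableE.
  by under eq_esum do rewrite gee0_abs ?lee_fin//.
have -> : (fun t => a t + b t) =
    (fun t => (pp (a t) + pp (b t)) - (nn (a t) + nn (b t))).
  by apply/funext => t; rewrite {1}(ppn (a t)) {1}(ppn (b t)); ring.
rewrite (@lsum_diff _ _ (C + D) (C + D))//; last 4 first.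
- by move=> t; rewrite addr_ge0.
- by move=> t; rewrite addr_ge0.
- exact: (l1_boundedD (ppC _ _ aC) (ppC _ _ bD)).
- exact: (l1_boundedD (nnC _ _ aC) (nnC _ _ bD)).
under eq_esum do rewrite EFinD.
rewrite esumD; [|by move=> *; rewrite lee_fin..].
under [in X in _ - X]eq_esum do rewrite EFinD.
rewrite esumD; [|by move=> *; rewrite lee_fin..].
rewrite !fineD ?(fin (pp \o a) C) ?(fin (pp \o b) D) ?(fin (nn \o a) C) ?(fin (nn \o b) D)//;
  try by [exact: ppC|exact: nnC|move=> t; exact: pp0|move=> t; exact: nn0].
by rewrite /lsum /pp /nn; ring.
Qed.

Lemma lsum0 : lsum (fun _ : Gamma => 0 : R) = 0.
Proof. by rewrite (@lsum_finsupp _ [::])// big_nil. Qed.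

Lemma lsumN a : lsum (fun t => - a t) = - lsum a.
Proof.
rewrite /lsum opprB; congr (_ - fine _).
by apply: eq_esum => t _; rewrite opprK.
Qed.

(** The inequality [le] comes from finite partial sums; applying it to [c^-1] gives the converse. *)
Lemma esumZ (c : R) a : 0 < c -> (forall t, 0 <= a t) ->
  \esum_(t in [set: Gamma]) (c * a t)%:E =
  (c%:E * \esum_(t in [set: Gamma]) (a t)%:E)%E.
Proof.
have le (d : R) b : 0 < d -> (\esum_(t in [set: Gamma]) (d * b t)%:E <=
    d%:E * \esum_(t in [set: Gamma]) (b t)%:E)%E.
  move=> d0; apply: ub_ereal_sup => _ [A [finA _] <-].
  rewrite fsbig_finite//= sumEFin -mulr_sumr EFinM lee_pmul2l ?fin_numE//.
  by apply: sum_le_esum; exact: fset_uniq.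
move=> c0 a0; apply/eqP; rewrite eq_le le//=.
rewrite -(@lee_pmul2l _ (c^-1)%:E) ?lte_fin ?invr_gt0//.
rewrite muleA -EFinM mulVf ?gt_eqF// mul1e.
have := le c^-1 (fun t => c * a t); rewrite invr_gt0 => /(_ c0).
by under eq_esum do rewrite mulKf ?gt_eqF//.
Qed.

Lemma lsumZ (c : R) a : lsum (fun t => c * a t) = c * lsum a.
Proof.
have pos d : 0 < d -> lsum (fun t => d * a t) = d * lsum a.
  move=> d0; rewrite /lsum.
  have e b : \esum_(t in [set: Gamma]) (Num.max (d * b t) 0)%:E =
      (d%:E * \esum_(t in [set: Gamma]) (Num.max (b t) 0)%:E)%E.
    rewrite -esumZ//; last by move=> t; rewrite le_max lexx orbT.
    by apply: eq_esum => t _; rewrite maxr_pMr ?ltW// mulr0.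
  under [in X in _ - X]eq_esum do rewrite -mulrN.
  rewrite e (e (fun t => - a t)) mulrBr.
  (* If the sum is infinite, [fine] is 0 on both sides. *)
  by congr (_ - _); case: esum => [r| |] //=;
    rewrite ?gt0_muley ?gt0_muleNy ?lte_fin//= mulr0.
have [c0|c0|->] := ltgtP c 0; first last.
- by rewrite mul0r -[RHS]lsum0; congr lsum; apply/funext => t; rewrite mul0r.
- exact: pos.
- have := pos (- c); rewrite oppr_gt0 => /(_ c0).
  by under eq_fun do rewrite mulNr; rewrite lsumN mulNr => /oppr_inj.
Qed.

Lemma lsum_sum (I : Type) (r : seq I) (a : I -> Gamma -> R) :
  (forall i, exists C, l1_bounded (a i) C) ->
  lsum (fun t => \sum_(i <- r) a i t) = \sum_(i <- r) lsum (a i).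
Proof.
move=> aC; suff [] : lsum (fun t => \sum_(i <- r) a i t) = \sum_(i <- r) lsum (a i) /\
    exists C, l1_bounded (fun t => \sum_(i <- r) a i t) C by [].
elim: r => [|i r [IH [C rC]]].
  under eq_fun do rewrite big_nil; rewrite lsum0 big_nil; split=> //.
  by exists 0 => T _; rewrite big1// => t _; rewrite normr0.
have [D aD] := aC i; under eq_fun do rewrite big_cons.
split; last by exists (D + C); exact: l1_boundedD.
by rewrite (lsumD aD rC) IH big_cons.
Qed.

End Lsum.

(** * Neumann series *)

Lemma cvg_lin_comb (R : realType) (I : Type) (r : seq I) (c : I -> R)
    (u : I -> nat -> R) (l : I -> R) :
  (forall i, u i @ \oo --> l i) ->
  (fun N => \sum_(i <- r) c i * u i N) @ \oo --> \sum_(i <- r) c i * l i.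
Proof.
move=> ul; elim: r => [|i r IH].
  by under eq_fun do rewrite big_nil; rewrite big_nil; exact: cvg_cst.
under eq_fun do rewrite big_cons; rewrite big_cons.
by apply: cvgD IH; apply: cvgM (ul i); exact: cvg_cst.
Qed.

Definition index_pairs (n : nat) (T : Type) (S : seq T) : seq ('I_n * T) :=
  [seq (k, p) | k <- index_enum 'I_n, p <- S].

Lemma sum_index_pairs (V : nmodType) (n : nat) (T : Type) (S : seq T)
    (F : 'I_n * T -> V) :
  \sum_(q <- index_pairs n S) F q = \sum_(k < n) \sum_(p <- S) F (k, p).
Proof. by rewrite big_allpairs_dep. Qed.

Section Neumann.
Context (R : realType) (Gamma : groupType) (n : nat).
Context (S : seq Gamma) (a : 'I_n -> 'I_n * Gamma -> R).
Context (d : 'I_n -> R) (theta : R).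
Let J := index_pairs n S.
Hypothesis d1 : forall m, 1 <= `|d m|.
Hypothesis theta01 : 0 <= theta < 1.
Hypothesis row_sum : forall m, \sum_(q <- J) `|a m q| <= theta * `|d m|.

Let mx := 'I_n -> 'I_n -> Gamma -> R.

(** Multiplication from the right by the off-diagonal part, divided by the diagonal entry; [left_op]
    multiplies from the left. *)
Definition right_op (A : mx) : mx := fun k m u =>
  (d m)^-1 * \sum_(q <- J) a m q * A k q.1 (u * q.2)%g.
Definition left_op (A : mx) : mx := fun k m u =>
  (d k)^-1 * \sum_(q <- J) a q.1 (k, q.2) * A q.1 m (q.2 * u)%g.
Definition scaled_one : mx := fun k m u =>
  if (k == m) && (u == 1%g) then (d m)^-1 else 0.
Definition neumann_term i : mx := iter i right_op scaled_one.

Lemma left_right_opC A : left_op (right_op A) = right_op (left_op A).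
Proof.
apply/funext => k; apply/funext => m; apply/funext => u.
rewrite /left_op /right_op.
under eq_bigr do rewrite !mulr_sumr.
under [in RHS]eq_bigr do rewrite !mulr_sumr.
rewrite !mulr_sumr; under eq_bigr do rewrite mulr_sumr.
under [in RHS]eq_bigr do rewrite mulr_sumr.
rewrite exchange_big/=; apply: eq_bigr => q _; apply: eq_bigr => q' _.
by rewrite mulgA; ring.
Qed.

(* Both sides collapse to [a m (k, p)] at [p = u^-1], as [p u = 1 <-> u p = 1]. *)
Lemma left_right_op_one : left_op scaled_one = right_op scaled_one.
Proof.
apply/funext => k; apply/funext => m; apply/funext => u.
rewrite /left_op /right_op /scaled_one.
rewrite !sum_index_pairs/=.
rewrite (bigD1 m)//= [X in _ + X]big1 ?addr0; last first.
  by move=> j /negbTE jm; rewrite big1// => p _; rewrite jm mulr0.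
rewrite [in RHS](bigD1 k)//= [X in _ * (_ + X)]big1 ?addr0; last first.
  by move=> j /negbTE jk; rewrite big1// => p _; rewrite eq_sym jk mulr0.
rewrite !mulr_sumr; apply: eq_bigr => p _; rewrite !eqxx/=.
have -> : ((p * u)%g == 1%g) = ((u * p)%g == 1%g) 
  by apply/eqP/eqP => /mulg1_eq <-; rewrite ?mulVg ?mulgV.
by case: ifP => _; ring.
Qed.

(** [left_op] sums coefficients along columns, which [row_sum] does not control, so it need not
    contract. Its agreement with [right_op] on the Neumann terms lets one series solve both fixpoint
    equations. *)
Lemma left_op_term i : left_op (neumann_term i) = neumann_term i.+1.
Proof.
elim: i => [|i IH]; first exact: left_right_op_one.
by rewrite [neumann_term i.+1]/= left_right_opC IH.
Qed.

(** Translations preserve $\ell^1$ norms, and the weights in [right_op] sum to at most [theta] after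
    division by [|d m|]; the initial term is controlled by [1 <= |d m|]. *)
Lemma neumann_term_bound i k m :
  l1_bounded (neumann_term i k m) (theta ^+ i).
Proof.
case/andP: theta01 => t0 t1.
have dp j : 0 < `|d j| by apply: lt_le_trans (d1 j).
elim: i m => [|i IH] m T uT.
  rewrite expr0 /neumann_term/= /scaled_one.
  apply: (@le_trans _ _ `|(d m)^-1|); last first.
    by rewrite normfV invf_le1.
  case: eqP => [_|_] /=; last by rewrite big1// => u _; rewrite normr0.
  have [T1|T1] := boolP (1%g \in T).
    rewrite (bigD1_seq 1%g)//= eqxx big1 ?addr0// => u /negbTE ->.
    by rewrite normr0.
  rewrite big_seq big1// => u uin; case: eqP => [u1|_]; last by rewrite normr0.
  by rewrite u1 (negbTE T1) in uin.
rewrite exprS [neumann_term _]/=.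
have -> : theta * theta ^+ i = `|d m|^-1 * (theta * `|d m| * theta ^+ i).
  by field; rewrite gt_eqF.
rewrite /right_op; under eq_bigr do rewrite normrM normfV.
rewrite -mulr_sumr ler_wpM2l ?invr_ge0//.
apply: (@le_trans _ _ (\sum_(u <- T) \sum_(q <- J)
    `|a m q| * `|neumann_term i k q.1 (u * q.2)%g|)).
  apply: ler_sum => u _; apply: le_trans (ler_norm_sum _ _ _) _.
  by apply: ler_sum => q _; rewrite normrM.
rewrite exchange_big/=; apply: le_trans (ler_wpM2r (exprn_ge0 _ t0) (row_sum m)).
rewrite mulr_suml; apply: ler_sum => q _; rewrite -mulr_sumr ler_wpM2l//.
rewrite -(big_map (fun u => u * q.2)%g xpredT (fun v => `|neumann_term i k q.1 v|)).
by apply: IH; rewrite map_inj_uniq//; exact: mulIg.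
Qed.

Lemma neumann_series_cvg k m u :
  cvgn (series (fun i => neumann_term i k m u)).
Proof.
case/andP: theta01 => t0 t1.
apply: normed_cvg; apply: (@series_le_cvg _ _ (geometric 1 theta)) => [i|i|i|].
- exact: normr_ge0.
- by rewrite /= mul1r exprn_ge0.
- rewrite /= mul1r; have := @neumann_term_bound i k m [:: u].
  by rewrite big_seq1; apply.
- by apply: is_cvg_geometric_series; rewrite ger0_norm.
Qed.

Definition neumann_sum : mx := fun k m u =>
  limn (series (fun i => neumann_term i k m u)).

(** Treats both operators at once: [c] holds the finitely many weights of [op] and [h] the places
    where its argument is read, so [op] commutes with the limit. *)
Lemma neumann_sum_eq (op : mx -> mx) (c : 'I_n -> 'I_n -> 'I_n * Gamma -> R)
    (h : 'I_n -> 'I_n -> Gamma -> 'I_n * Gamma -> 'I_n * 'I_n * Gamma) :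
  (forall A k m u, op A k m u =
     \sum_(q <- J) c k m q * A (h k m u q).1.1 (h k m u q).1.2 (h k m u q).2) ->
  (forall i, op (neumann_term i) = neumann_term i.+1) ->
  forall k m u, neumann_sum k m u = scaled_one k m u + op neumann_sum k m u.
Proof.
move=> opE op_term k m u.
have S1 : series (fun i => neumann_term i k m u) @ \oo --> neumann_sum k m u.
  exact: neumann_series_cvg.
have {S1} : (fun N => series (fun i => neumann_term i k m u) N.+1) @ \oo -->
    neumann_sum k m u by rewrite (cvg_shiftS (series _)).
rewrite opE; have -> : (fun N => series (fun i => neumann_term i k m u) N.+1) =
    (fun N => scaled_one k m u + \sum_(q <- J) c k m q *
      series (fun i => neumann_term i (h k m u q).1.1 (h k m u q).1.2 (h k m u q).2) N).
  apply/funext => N; rewrite /series/= big_nat_recl//; congr (_ + _).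
  under eq_bigr do rewrite -op_term opE.
  by rewrite exchange_big/=; apply: eq_bigr => q _; rewrite mulr_sumr.
move=> /(cvg_unique (@Rhausdorff R)); apply.
apply: cvgD; first exact: cvg_cst.
by apply: cvg_lin_comb => q; exact: neumann_series_cvg.
Qed.

Lemma neumann_sum_right k m u :
  neumann_sum k m u = scaled_one k m u + right_op neumann_sum k m u.
Proof.
apply: (@neumann_sum_eq right_op (fun k m q => (d m)^-1 * a m q)
  (fun k m u q => (k, q.1, (u * q.2)%g))) => // A k' m' u'.
by rewrite /right_op mulr_sumr; apply: eq_bigr => q _; rewrite mulrA.
Qed.

Lemma neumann_sum_left k m u :
  neumann_sum k m u = scaled_one k m u + left_op neumann_sum k m u.
Proof.
apply: (@neumann_sum_eq left_op (fun k m q => (d k)^-1 * a q.1 (k, q.2))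
  (fun k m u q => (q.1, m, (q.2 * u)%g))) => [A k' m' u'|i].
  by rewrite /left_op mulr_sumr; apply: eq_bigr => q _; rewrite mulrA.
exact: left_op_term.
Qed.

Lemma neumann_sum_bound k m : l1_bounded (neumann_sum k m) (1 - theta)^-1.
Proof.
case/andP: theta01 => t0 t1 T uT.
have cv : (fun N => \sum_(u <- T) 1 * `|series (fun i => neumann_term i k m u) N|) @ \oo
    --> \sum_(u <- T) 1 * `|neumann_sum k m u|.
  by apply: cvg_lin_comb => u; apply: cvg_norm; exact: neumann_series_cvg.
have -> : \sum_(u <- T) `|neumann_sum k m u| = \sum_(u <- T) 1 * `|neumann_sum k m u|.
  by apply: eq_bigr => u _; rewrite mul1r.
rewrite -(cvg_lim (@Rhausdorff R) cv).
apply: limr_le; first by apply/cvg_ex; eexists; exact: cv.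
near=> N; under eq_bigr do rewrite mul1r.
apply: (@le_trans _ _ (\sum_(0 <= i < N) theta ^+ i)).
  rewrite /series/=; apply: (@le_trans _ _ (\sum_(u <- T) \sum_(0 <= i < N)
    `|neumann_term i k m u|)); first by apply: ler_sum => u _; exact: ler_norm_sum.
  rewrite exchange_big/=; apply: ler_sum => i _; exact: neumann_term_bound.
have -> : \sum_(0 <= i < N) theta ^+ i = series (geometric 1 theta) N.
  by rewrite /series/=; under [RHS]eq_bigr do rewrite mul1r.
rewrite geometric_seriesE ?lt_eqF//= mul1r ler_pdivrMr ?subr_gt0//.
rewrite mulVf ?gt_eqF ?subr_gt0//.
by rewrite lerBlDr lerDl exprn_ge0.
Unshelve. all: by end_near. Qed.

End Neumann.

(** * Inverting a row lopsided matrix *)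

Section ShiftedSupport.
Context (Gamma : groupType) (n : nat).
Context (f : 'I_n -> 'I_n -> Gamma -> int) (Mk : 'I_n -> int) (sk : 'I_n -> Gamma).
Context (g : 'I_n -> 'I_n -> Gamma -> int).

(* The coefficient of [p] in [g^{(mk)} s_k^{-1}], for [q = (k, p)]. *)
Definition off_diag (m : 'I_n) (q : 'I_n * Gamma) : int := g m q.1 (q.2 * sk q.1)%g.

(** Multiplying supports by [s_k^-1] on the right puts the diagonal at [1] and the rest of [f] in a
    finite list [S] inside a semigroup [Q] avoiding [1]; the order is then no longer mentioned. *)
Record shifted_lopsided (S : seq Gamma) (Q : set Gamma) : Prop := ShiftedLopsided {
  shifted_uniq : uniq S;
  shifted_sub : forall p, p \in S -> Q p;
  shifted_mul : forall p q, Q p -> Q q -> Q (p * q)%g;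
  shifted_one : ~ Q 1%g;
  shifted_supp : forall k m p, p \notin S -> g k m (p * sk m)%g = 0;
  shifted_f : forall k m t, f k m t =
    (if (k == m) && (t == sk k) then Mk k else 0) - g k m t;
  shifted_row : forall m,
    (\sum_(q <- index_pairs n S) absz (off_diag m q) < absz (Mk m))%N }.

(** Right invariance turns [s_m < t] into [1 < t s_m^-1], so [Q] is taken to be the elements
    strictly above [1], and [S] collects the shifted supports. *)
Lemma pos_row_lopsided_shifted : pos_row_lopsided f Mk sk g ->
  exists S Q, shifted_lopsided S Q.
Proof.
case=> gfin fE gdiag grow [le [lerefl leanti letrans leM leg]].
pose S := undup (flatten [seq [seq (t * (sk km.2)^-1)%g | t <- fset_set (zsupp (g km.1 km.2))]
                         | km <- enum {: 'I_n * 'I_n}]).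
have SP k m t : g k m t != 0 -> (t * (sk m)^-1)%g \in S.
  move=> gt; rewrite mem_undup; apply/flatten_mapP; exists (k, m).
    by rewrite mem_enum.
  by apply: map_f; rewrite in_fset_set//; exact/mem_set.
have PS p : p \in S -> le 1%g p && (1%g != p).
  rewrite mem_undup => /flatten_mapP[[k m] _ /mapP[t]].
  rewrite in_fset_set// => /set_mem/= /leg[let_ /negP ne] ->.
  rewrite -(mulgV (sk m)) -leM let_ /=; apply/negP => /eqP /mulIg e.
  by apply: ne; rewrite e.
have gS k m p : p \notin S -> g k m (p * sk m)%g = 0.
  by move=> pS; apply/eqP; apply: contraNT pS => /SP; rewrite mulgK.
exists S, [set p | le 1%g p && (1%g != p)]; split=> //=.
- exact: undup_uniq.
- move=> p q /andP[lep pn1] /andP[leq qn1].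
  have leqpq : le q (p * q)%g by rewrite -{1}(mul1g q) -leM.
  rewrite (letrans _ _ _ leq leqpq)/=; apply/negP => /eqP e.
  (* If [p q = 1] then [q <= 1], against [1 < q]. *)
  by rewrite -e in leqpq; move/negP: qn1; apply; rewrite (leanti 1%g q)// leq.
- by rewrite eqxx andbF.
move=> m; rewrite sum_index_pairs/=.
rewrite -ltz_nat abszE (le_lt_trans _ (grow m))//.
rewrite (big_morph Posz PoszD erefl); apply: ler_sum => k _.
rewrite (big_morph Posz PoszD erefl) /zl1norm.
rewrite (@fsbig_widen _ _ _ _ _ [set` [seq (p * sk k)%g | p <- S]])/=; last 2 first.
- move=> t /= gt; apply/mapP; exists (t * (sk k)^-1)%g; first exact: (SP m k t gt).
  by rewrite mulgVK.
- by move=> t /= [_ /negP]; rewrite negbK => /eqP ->; rewrite normr0.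
rewrite -fsbig_seq; last by rewrite map_inj_uniq ?undup_uniq//; exact: mulIg.
by rewrite big_map; apply: ler_sum => p _; rewrite abszE.
Qed.
End ShiftedSupport.

(** * The inverse as a Neumann series *)

Section Inverse.
Context (R : realType) (Gamma : groupType) (n : nat).
Context (f : 'I_n -> 'I_n -> Gamma -> int) (Mk : 'I_n -> int) (sk : 'I_n -> Gamma).
Context (g : 'I_n -> 'I_n -> Gamma -> int) (S : seq Gamma) (Q : set Gamma).
Hypothesis lop : shifted_lopsided f Mk sk g S Q.

Local Notation J := (index_pairs n S).
Local Notation coef := (off_diag sk g).
Local Notation F := (zstar R f).

Lemma one_notin_support : 1%g \notin S.
Proof. by apply/negP => /(shifted_sub lop); exact: (shifted_one lop). Qed.

(** The diagonal term sits at [p = 1] and the terms of [g] at [p] in [S], and these places are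
    disjoint. *)
Lemma lsum_shifted (c : Gamma -> R) m k :
  lsum (fun p => c p * (f m k (p * sk k)%g)%:~R) =
  (if m == k then (Mk m)%:~R * c 1%g else 0) -
  \sum_(p <- S) (coef m (k, p))%:~R * c p.
Proof.
have S1 := one_notin_support.
rewrite (@lsum_finsupp _ _ _ (1%g :: S))/=; last 2 first.
- by rewrite S1 (shifted_uniq lop).
- move=> p; rewrite inE negb_or => /andP[p1 pS]; rewrite (shifted_f lop).
  rewrite (shifted_supp lop)// subr0; case: eqP => [->|_]/=; last by rewrite mulr0.
  by rewrite -{2}(mul1g (sk k)) (inj_eq (mulIg _)) (negbTE p1) mulr0.
rewrite big_cons; congr (_ + _).
  rewrite (shifted_f lop) (shifted_supp lop)// subr0 mul1g.
  by case: eqP => [->|_]/=; rewrite ?eqxx ?mulr0// mulrC.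
rewrite -sumrN big_seq [RHS]big_seq; apply: eq_bigr => p pS; rewrite (shifted_f lop).
have p1 : p == 1%g = false by apply: contraNF S1 => /eqP <-.
case: eqP => [->|_]/=; last by rewrite /off_diag sub0r mulrNz; ring.
rewrite -{2}(mul1g (sk k)) (inj_eq (mulIg _)) p1.
by rewrite /off_diag sub0r mulrNz; ring.
Qed.

Lemma rvmul_zstar (x : Gamma -> 'I_n -> R) t m :
  rvmul x F t m = (Mk m)%:~R * x (t * sk m)%g m -
    \sum_(q <- J) (coef m q)%:~R * x (t * (q.2 * sk q.1))%g q.1.
Proof.
rewrite /rvmul sum_index_pairs.
transitivity (\sum_(k < n) ((if m == k then (Mk m)%:~R * x (t * sk m)%g m else 0) -
   \sum_(p <- S) (coef m (k, p))%:~R * x (t * (p * sk k))%g k)).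
  apply: eq_bigr => k _.
  (* The substitution [s = (p s_k)^-1] undoes the inversion in [zstar] and moves the diagonal to
     [p = 1]. *)
  rewrite -(@lsum_reindex _ _ (fun p => (p * sk k)^-1)%g (fun s => s^-1 * (sk k)^-1)%g).
  - rewrite /zstar /comp/=; under eq_fun do rewrite !invgK.
    rewrite lsum_shifted; congr (_ - _).
    by case: eqP => // ->; rewrite mul1g.
  - by move=> p; rewrite invgK mulgK.
  - by move=> p; rewrite mulgVK invgK.
rewrite sumrB; congr (_ - _).
by rewrite -big_mkcond/= (big_pred1 m)// => k; rewrite /= eq_sym.
Qed.

Lemma contraction_constant : exists theta : R, 0 <= theta < 1 /\
  forall m, (\sum_(q <- J) absz (coef m q))%:R <= theta * (absz (Mk m))%:R.
Proof.
pose K := (\sum_(m < n) absz (Mk m))%N.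
(* Integer row sums are at most [|M_m| - 1], and [|M_m| <= K] gives [|M_m| / (K + 1) <= 1]; hence
   this constant serves all rows at once. *)
exists (1 - K.+1%:R^-1); split.
  rewrite subr_ge0 invf_le1 ?ltr0n// ler1n/=.
  by rewrite ltrBlDr ltrDl invr_gt0 ltr0n.
move=> m; have := shifted_row lop m; rewrite -(@ler_nat R) -(@natr1 R) => h.
have NK : (absz (Mk m))%:R / K.+1%:R <= 1 :> R.
  rewrite ler_pdivrMr ?ltr0n// mul1r ler_nat ltnW// ltnS /K (bigD1 m)//=.
  exact: leq_addr.
rewrite mulrBl mul1r [_^-1 * _]mulrC lerBrDr.
by apply: le_trans h; rewrite lerD2l.
Qed.

Lemma Mk_norm m : `|(Mk m)%:~R : R| = (absz (Mk m))%:R.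
Proof. by rewrite -intr_norm -abszE. Qed.

Lemma Mk_gt0 m : (0 < absz (Mk m))%N.
Proof. exact: leq_ltn_trans (shifted_row lop m). Qed.

Lemma Mk_neq0 m : (Mk m)%:~R != 0 :> R.
Proof. by rewrite -normr_gt0 Mk_norm ltr0n Mk_gt0. Qed.

Lemma zstar_invertible : exists H, is_l1_inverse F H.
Proof.
have [theta [theta01 row_sum]] := contraction_constant.
pose a m q : R := (coef m q)%:~R; pose d m : R := (Mk m)%:~R.
have d1 m : 1 <= `|d m| by rewrite Mk_norm ler1n Mk_gt0.
have rs m : \sum_(q <- J) `|a m q| <= theta * `|d m|.
  rewrite Mk_norm; apply: le_trans (row_sum m); rewrite natr_sum.
  by apply: ler_sum => q _; rewrite /a -intr_norm -abszE.
(* [W k m t = H k m (t s_m)] turns both inverse identities into fixpoint equations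
   of [right_op] and [left_op]. *)
pose W := neumann_sum S a d.
exists (fun k m t => W k m (t * (sk m)^-1)%g); split=> [k m|].
  apply: (@l1_bounded_is_l1 _ _ _ (1 - theta)^-1) => T uT.
  rewrite -(big_map (fun t => t * (sk m)^-1)%g xpredT (fun v => `|W k m v|)).
  apply: (neumann_sum_bound d1 theta01 rs).
  by rewrite map_inj_uniq//; exact: mulIg.
split; apply/funext => k; apply/funext => m; apply/funext => t.
- pose u := (sk k * t * (sk m)^-1)%g.
  transitivity (d k * W k m u - \sum_(q <- J) a q.1 (k, q.2) * W q.1 m (q.2 * u)%g).
    rewrite sum_index_pairs /mconv.
    transitivity (\sum_(j < n) ((if j == k then d k * W k m u else 0) -
        \sum_(p <- S) a j (k, p) * W j m (p * u)%g)).
      apply: eq_bigr => j _.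
      rewrite -(@lsum_reindex _ _ (fun p => (p * sk k) * t)%g
        (fun s => (s * t^-1) * (sk k)^-1)%g).
      + rewrite /zstar /comp/=; under eq_fun do rewrite invgM invgK mulgK.
        under eq_fun do rewrite mulrC.
        rewrite (@lsum_shifted (fun p => W j m (p * sk k * t * (sk m)^-1)%g)).
        congr (_ - _); last by apply: eq_bigr => p _; rewrite /u !mulgA.
        by case: eqP => // ->; rewrite mul1g.
      + by move=> p; rewrite !mulgK.
      + by move=> p; rewrite !mulgVK.
    rewrite sumrB; congr (_ - _).
    by rewrite -big_mkcond/= (big_pred1 k).
  rewrite {1}/W (neumann_sum_left d1 theta01 rs) mulrDr /left_op.
  rewrite mulVKf ?Mk_neq0// addrK /scaled_one /mone.
  have -> : (k == m) && (u == 1%g) = (k == m) && (t == 1%g).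
    case: (eqVneq k m) => //= km; rewrite /u km.
    rewrite -(inj_eq (mulIg (sk m))) mulgVK mul1g -{2}(mulg1 (sk m)).
    by rewrite (inj_eq (mulgI _)).
  case: ifP => [/andP[/eqP <- _]|_]; last by rewrite mulr0.
  by rewrite divff ?Mk_neq0.
(* By definition, row [k] of this product is row [k] of the candidate inverse times [F]. *)
- rewrite -[LHS]/(rvmul (fun t j => W k j (t * (sk j)^-1)%g) F t m).
  rewrite rvmul_zstar mulgK {1}/W (neumann_sum_right d1 theta01 rs) mulrDr /right_op.
  rewrite mulVKf ?Mk_neq0//; under [in X in _ - X]eq_bigr do rewrite mulgA mulgK.
  rewrite addrK /scaled_one /mone; case: ifP => _; last by rewrite mulr0.
  by rewrite divff ?Mk_neq0.
Qed.
End Inverse.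

(** * Fibres of phi_f *)

Section Frac.
Local Notation frac := Defs.frac.
Context (R : realType).
Implicit Types r : R.

Lemma frac_itv r : 0 <= frac r < 1.
Proof.
have /andP[] := floor_itv r; rewrite /frac intrD => h1 h2.
by rewrite subr_ge0 h1/= ltrBlDr addrC.
Qed.

Lemma frac_int (z : int) : frac (z%:~R : R) = 0.
Proof. by rewrite /frac floorK ?subrr// intr_int. Qed.

Lemma measurable_frac : measurable_fun [set: R] (@frac R).
Proof.
apply: measurable_funB => //; apply: nondecreasing_measurable => // r s rs.
by rewrite ler_int le_floor.
Qed.
End Frac.

Section Kernel.
Context (R : realType) (Gamma : groupType) (n : nat).
Context (f : 'I_n -> 'I_n -> Gamma -> int) (Mk : 'I_n -> int) (sk : 'I_n -> Gamma).
Context (g : 'I_n -> 'I_n -> Gamma -> int) (S : seq Gamma) (Q : set Gamma).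
Hypothesis lop : shifted_lopsided f Mk sk g S Q.

Local Notation J := (index_pairs n S).
Local Notation coef := (off_diag sk g).
Local Notation F := (zstar R f).
Local Notation H := (l1inv F).
Local Notation frac := Defs.frac.

Lemma l1inv_zstarP : is_l1_inverse F H.
Proof.
rewrite /l1inv; case: pselect => [ex|[]]; first exact: proj2_sig.
exact: (zstar_invertible R lop).
Qed.

Lemma l1inv_bounded : exists2 C : R, 0 <= C & forall j k, l1_bounded (H j k) C.
Proof.
have [Hl1 _] := l1inv_zstarP.
pose C j k := sval (cid (is_l1_bounded (Hl1 j k))).
have CP j k : l1_bounded (H j k) (C j k) by rewrite /C; case: cid.
have C0 j k : 0 <= C j k by have := CP j k [::] isT; rewrite big_nil.
exists (\sum_j \sum_k C j k) => [|j k T uT].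
  by do 2 (apply: sumr_ge0 => ? _).
apply: le_trans (CP j k T uT) _.
rewrite (bigD1 j)//= (bigD1 k)//= -addrA lerDl addr_ge0//.
  exact: sumr_ge0.
by do 2 (apply: sumr_ge0 => ? _).
Qed.

Lemma rvmul_bounded (y : Gamma -> 'I_n -> R) (B : R) :
  (forall t k, `|y t k| <= B) -> exists C : R, forall t k, `|rvmul y H t k| <= C.
Proof.
move=> yB; have [C C0 HC] := l1inv_bounded.
exists (\sum_(j < n) `|B| * C) => t k.
apply: le_trans (ler_norm_sum _ _ _) _; apply: ler_sum => j _.
apply: lsum_le_bound; apply: l1_boundedZ => // s.
exact: le_trans (yB _ _) (ler_norm _).
Qed.

(** Associativity $(yH)F=y(HF)$ for bounded $y$: [F] has finite support, so only finite combinations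
    have to be moved inside [lsum]. *)
Lemma rvmul_l1inv_zstar (y : Gamma -> 'I_n -> R) (B : R) t m :
  (forall t k, `|y t k| <= B) -> rvmul (rvmul y H) F t m = y t m.
Proof.
move=> yB; have [C C0 HC] := l1inv_bounded.
have B0 : 0 <= `|B| by [].
have yB' s j : `|y s j| <= `|B| by apply: le_trans (yB _ _) (ler_norm _).
(* Reindexing moves the translation by [v] onto [H]; the factor of [y] is then common to all terms,
   and they combine inside one [lsum]. *)
pose psi j k v := lsum (fun s => y (t * s^-1)%g j * H j k (s * v)%g).
have psiE k v : rvmul y H (t * v)%g k = \sum_(j < n) psi j k v.
  apply: eq_bigr => j _.
  rewrite -(@lsum_reindex _ _ (fun s => s * v)%g (fun s => s * v^-1)%g).
  - by congr lsum; apply/funext => s; rewrite /= invgM mulgA mulgK.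
  - by move=> s; rewrite mulgK.
  - by move=> s; rewrite mulgVK.
have shiftC j k v : l1_bounded (fun s => y (t * s^-1)%g j * H j k (s * v)%g) (`|B| * C).
  apply: (@l1_boundedZ _ _ `|B| (fun s => H j k (s * v)%g)) => // T uT.
  rewrite -(big_map (fun s => s * v)%g xpredT (fun w => `|H j k w|)).
  by apply: HC; rewrite map_inj_uniq//; exact: mulIg.
have scaleC (c : R) b E : l1_bounded b E -> l1_bounded (fun s : Gamma => c * b s) (`|c| * E).
  by move=> bE; apply: (@l1_boundedZ _ _ `|c| b E (fun=> c)).
rewrite (rvmul_zstar lop) psiE.
under [in X in _ - X]eq_bigr do rewrite psiE mulr_sumr.
rewrite exchange_big/= mulr_sumr -sumrB.
transitivity (\sum_(j < n) lsum (fun s => y (t * s^-1)%g j * mone R j m s)).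
  apply: eq_bigr => j _; have [_ [_ HF]] := l1inv_zstarP.
  rewrite -HF -(lsumZ ((Mk m)%:~R)).
  rewrite -(eq_bigr _ (fun q _ => lsumZ (coef m q)%:~R _)).
  rewrite -lsum_sum; last by move=> q; eexists; apply: scaleC; exact: shiftC.
  rewrite -lsumN.
  have [D DC] : exists D : R, l1_bounded (fun s => - \sum_(q <- J) (coef m q)%:~R *
       (y (t * s^-1)%g j * H j q.1 (s * (q.2 * sk q.1))%g)) D.
    exists (\sum_(q <- J) `|(coef m q)%:~R| * (`|B| * C)) => T uT.
    under eq_bigr do rewrite normrN.
    apply: (@le_trans _ _ (\sum_(s <- T) \sum_(q <- J) `|(coef m q)%:~R *
       (y (t * s^-1)%g j * H j q.1 (s * (q.2 * sk q.1))%g)|)).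
      by apply: ler_sum => s _; exact: ler_norm_sum.
    rewrite exchange_big/=; apply: ler_sum => q _.
    by apply: scaleC => //; exact: shiftC.
  rewrite -(lsumD (scaleC _ _ _ (shiftC j m (sk m))) DC).
  congr lsum; apply/funext => s.
  rewrite -[mconv _ _ _ _ _]/(rvmul (fun t j' => H j j' t) F s m) (rvmul_zstar lop).
  rewrite mulrBr mulrCA; congr (_ - _); rewrite mulr_sumr.
  by apply: eq_bigr => q _; rewrite mulrCA.
rewrite (bigD1 m)//= big1 ?addr0.
  rewrite (@lsum_finsupp _ _ _ [:: 1%g])//; last first.
    by move=> s; rewrite inE => /negbTE s1; rewrite /mone s1 andbF mulr0.
  by rewrite big_seq1 /mone !eqxx mulr1 invg1 mulg1.
move=> j /negbTE jm; rewrite -[RHS](@lsum0 R Gamma); congr lsum.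
by apply/funext => s; rewrite /mone jm mulr0.
Qed.

Local Notation real_of y := (fun (s : Gamma) (k : 'I_n) => (y s k)%:R : R).

Lemma SfG_bounded (y : Gamma -> 'I_n -> nat) : SfG Mk y ->
  forall t k, `|(y t k)%:R : R| <= (\sum_j absz (Mk j))%:R.
Proof.
move=> yS t k; rewrite normr_nat ler_nat (bigD1 k)//=.
by apply: leq_trans (leq_addr _ _); apply: ltnW; exact: yS.
Qed.

Lemma phi_Xf (y : Gamma -> 'I_n -> nat) : SfG Mk y -> Xf f (phi R f y).
Proof.
move=> yS; split=> [t k|t m]; first exact: frac_itv.
have yE := @rvmul_l1inv_zstar _ _ t m (SfG_bounded yS).
rewrite (rvmul_zstar lop) in yE; rewrite (rvmul_zstar lop) /phi /frac.
set r := rvmul _ _ in yE *.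
suff [z ->] : exists z : int, (Mk m)%:~R * (r (t * sk m)%g m - (Num.floor (r (t * sk m)%g m))%:~R) -
    \sum_(q <- J) (coef m q)%:~R * (r (t * (q.2 * sk q.1))%g q.1 -
       (Num.floor (r (t * (q.2 * sk q.1))%g q.1))%:~R) = z%:~R by exact: frac_int.
(* With [r = y H] one has [r F = y]; subtracting the integral vector of floors times [F] leaves this
   integer. *)
exists ((y t m)%:Z - (Mk m * Num.floor (r (t * sk m)%g m) -
  \sum_(q <- J) coef m q * Num.floor (r (t * (q.2 * sk q.1))%g q.1))).
rewrite !rmorphB/= rmorphM/= rmorph_sum/= -[(y t m)%:~R]/((y t m)%:R) -yE.
rewrite mulrBr; under eq_bigr do rewrite mulrBr.
under [in RHS]eq_bigr do rewrite rmorphM/=.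
by rewrite sumrB; ring.
Qed.

Lemma phi_equivariant (s : Gamma) (y : Gamma -> 'I_n -> nat) :
  phi R f (gshift s y) = gshift s (phi R f y).
Proof.
apply/funext => t; apply/funext => m; rewrite /gshift /phi /rvmul.
congr frac; apply: eq_bigr => k _; congr lsum.
by apply/funext => u; rewrite mulgA.
Qed.

Lemma phi_eq_integral (y y' : Gamma -> 'I_n -> nat) :
  SfG Mk y -> SfG Mk y' -> phi R f y' = phi R f y ->
  exists z : Gamma -> 'I_n -> int,
    (exists B : nat, forall t k, (absz (z t k) <= B)%N) /\
    forall t m, (y t m)%:Z - (y' t m)%:Z = Mk m * z (t * sk m)%g m -
      \sum_(q <- J) coef m q * z (t * (q.2 * sk q.1))%g q.1.
Proof.
move=> yS y'S e; pose r := rvmul (real_of y) H; pose r' := rvmul (real_of y') H.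
(* Equal fractional parts make [r - r'] equal to this difference of floors, hence integral. *)
pose z t k := Num.floor (r t k) - Num.floor (r' t k).
have zE t k : (z t k)%:~R = r t k - r' t k.
  have := congr1 (fun x : Gamma -> 'I_n -> R => x t k) e.
  rewrite /phi /frac -/r -/r' /z rmorphB/= => h.
  by lra.
exists z; split.
  have [C rC] := rvmul_bounded (SfG_bounded yS).
  have [C' r'C] := rvmul_bounded (SfG_bounded y'S).
  exists (Num.bound (`|C| + `|C'|)) => t k.
  rewrite -(@ler_nat R) ltW//; apply: le_lt_trans (archi_boundP _); last by rewrite addr_ge0.
  rewrite -[(absz _)%:R]/((absz (z t k))%:Z%:~R) abszE intr_norm zE.
  apply: le_trans (ler_normB _ _) _; apply: lerD.
    exact: le_trans (rC _ _) (ler_norm _).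
  exact: le_trans (r'C _ _) (ler_norm _).
move=> t m; apply: (@intr_inj R); rewrite !rmorphB/= rmorphM/= rmorph_sum/=.
rewrite -[(y t m)%:~R]/((y t m)%:R) -[(y' t m)%:~R]/((y' t m)%:R).
rewrite -(rvmul_l1inv_zstar t m (SfG_bounded yS)) -(rvmul_l1inv_zstar t m (SfG_bounded y'S)).
rewrite !(rvmul_zstar lop) -/r -/r' zE.
under [in RHS]eq_bigr do rewrite rmorphM/= zE mulrBr.
by rewrite sumrB; ring.
Qed.

End Kernel.

(** * Envelopes and their expectations *)

(** Raising [C] by one moves the window of [N] consecutive numerators: [C %/ N] leaves and
    [(C + N) %/ N], one larger, enters. *)
Lemma sum_divn_shift (N C : nat) : (0 < N)%N ->
  (\sum_(a < N) (a + C) %/ N = C)%N.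
Proof.
case: N => // N _; elim: C => [|C IH].
  by rewrite big1// => a _; rewrite addn0 divn_small.
rewrite -[in RHS]IH big_ord_recr big_ord_recl/= add0n addnC addnS -addSn.
rewrite divnDl ?dvdnn// divnn/= add1n addSn; congr _.+1; congr addn.
by apply: eq_bigr => a _; rewrite /bump /= addnS add1n addSn.
Qed.

Section Envelope.
Context (Gamma : groupType) (n : nat) (S : seq Gamma) (Q : set Gamma).
Context (a : 'I_n -> 'I_n * Gamma -> int) (N : 'I_n -> nat) (B : nat).
Hypothesis N0 : forall m, (0 < N m)%N.
Hypothesis QS : forall p, p \in S -> Q p.
Hypothesis QM : forall p q, Q p -> Q q -> Q (p * q)%g.
Hypothesis Q1 : ~ Q 1%g.

Local Notation J := (index_pairs n S).
Local Notation config := (Gamma -> 'I_n -> nat).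
Implicit Types (y : config) (b : bool) (j : nat) (t : Gamma) (m : 'I_n).

(** The bound on [- x] uses [y' <= N - 1], so the digit enters as [N - 1 - v]; this reflection
    preserves the uniform law. *)
Definition reflect_digit b m (v : nat) := if b then ((N m).-1 - v)%N else v.

(* [envelope j false] bounds [x t m] and [envelope j true] bounds [- x t m]; the
   sign flips when a negative coefficient is crossed. *)
Fixpoint envelope j b t m y : nat :=
  if j is j'.+1 then
    ((reflect_digit b m (y t m) + \sum_(q <- J) absz (a m q) *
       envelope j' (b (+) (a m q < 0)%R) (t * q.2)%g q.1 y) %/ N m)%N
  else B.

(** Eliminating [y'] by [0 <= y' < N] gives upper bounds for [N x] and [- N x]; integrality of [x]
    allows rounding down after division. *)
Lemma envelopeP y y' (x : Gamma -> 'I_n -> int) :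
  (forall t m, (y' t m < N m)%N) -> (forall t m, (y t m < N m)%N) ->
  (forall t m, (absz (x t m) <= B)%N) ->
  (forall t m, (y t m)%:Z - (y' t m)%:Z =
     (N m)%:Z * x t m - \sum_(q <- J) a m q * x (t * q.2)%g q.1) ->
  forall j b t m, (-1) ^+ b * x t m <= (envelope j b t m y)%:Z.
Proof.
move=> y'N yN xB xE; elim=> [|j IH] b t m.
  rewrite /= (le_trans (ler_norm _))// normrM normrX normrN1 expr1n mul1r.
  by rewrite -abszE lez_nat.
rewrite [envelope _ _ _ _ _]/= -divz_nat lez_divRL ?ltz_nat//.
rewrite PoszD (big_morph Posz PoszD erefl).
have sumE : (-1) ^+ b * (\sum_(q <- J) a m q * x (t * q.2)%g q.1) <=
    \sum_(q <- J) (absz (a m q) * envelope j (b (+) (a m q < 0)%R) (t * q.2)%g q.1 y)%:Z.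
  rewrite mulr_sumr; apply: ler_sum => q _.
  (* The coefficient is its sign times its absolute value; the sign joins [b] before the induction
     hypothesis applies. *)
  rewrite PoszM abszE {1}[a m q]intEsign mulrCA -!mulrA mulrCA.
  rewrite ler_wpM2l//; apply: le_trans (IH _ _ _).
  by rewrite mulrA -signr_addb addbC.
move: sumE (xE t m) (y'N t m) (yN t m); rewrite /reflect_digit; case: b.
  move: (\sum_(q <- J) a m q * _) (\sum_(q <- J) _%:Z) => Sa Se.
  by rewrite expr1; lia.
move: (\sum_(q <- J) a m q * _) (\sum_(q <- J) _%:Z) => Sa Se.
by rewrite expr0; lia.
Qed.

(* The coordinates that [envelope j b t m] reads. *)
Fixpoint tree j t : seq Gamma :=
  if j is j'.+1 then t :: flatten [seq tree j' (t * q.2)%g | q <- J] else [::].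

Lemma index_pairs_mem q : q \in J -> q.2 \in S.
Proof. by move=> /allpairsP[[k p] [_ pS ->]]. Qed.

Lemma eq_envelope j b t m y y' : {in tree j t, forall u, y u = y' u} ->
  envelope j b t m y = envelope j b t m y'.
Proof.
elim: j b t m => //= j IH b t m e; rewrite e ?mem_head//; congr (_ %/ _)%N.
congr addn; rewrite big_seq [RHS]big_seq; apply: eq_bigr => q qJ.
congr muln; apply: IH => u uin; apply: e; rewrite inE; apply/orP; right.
by apply/flatten_mapP; exists q.
Qed.

Lemma mem_tree j t u : u \in tree j t -> u = t \/ exists2 p, Q p & u = (t * p)%g.
Proof.
elim: j t => //= j IH t; rewrite inE => /orP[/eqP ->|]; first by left.
move=> /flatten_mapP[q /index_pairs_mem/QS qQ /IH[->|[p pQ ->]]]; right.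
  by exists q.2.
by exists (q.2 * p)%g; [exact: QM|rewrite mulgA].
Qed.

(** If [t] occurred, [1] would be [p] or a product of [p] with an element of [Q]. Hence the subtrees
    below [t] never read the digit at [t]: this is the use of positivity. *)
Lemma notin_tree j t p : p \in S -> t \notin tree j (t * p)%g.
Proof.
move=> /QS pQ; apply/negP => /mem_tree[|[p' p'Q]].
  by rewrite -{1}(mulg1 t) => /mulgI p1; apply: Q1; rewrite p1.
by rewrite -mulgA -{1}(mulg1 t) => /mulgI p1; apply: Q1; rewrite p1; exact: QM.
Qed.

Lemma envelope_shift s j b t m y :
  envelope j b t m (gshift s y) = envelope j b (s^-1 * t)%g m y.
Proof.
elim: j b t m => //= j IH b t m; congr ((_ + _) %/ _)%N.
by apply: eq_bigr => q _; rewrite IH mulgA.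
Qed.

End Envelope.

(** * Averaging over single coordinates *)

Section Resampling.
Context (R : realType) (Gamma : groupType) (n : nat) (Mk : 'I_n -> int).
Context (nu : Sf Mk -> R).
Hypothesis nu_ge0 : forall s, 0 <= nu s.
Hypothesis nu_sum : \sum_(s : Sf Mk) nu s = 1.

Local Notation config := (Gamma -> 'I_n -> nat).
Implicit Types (h : config -> R) (y : config) (t u : Gamma) (T : seq Gamma).

Definition update y t (v : 'I_n -> nat) : config := fun u => if u == t then v else y u.

(* Conditional expectation given all coordinates other than [t]. *)
Definition resample t h : config -> R :=
  fun y => \sum_(s : Sf Mk) nu s * h (update y t (Sf_emb s)).

(** Averages out every coordinate in [T]. When [h] reads only [T], this is its expectation, written
    with finite sums. *)
Definition resample_seq T h : config -> R := foldr resample h T.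

Lemma update_update y t v w : update (update y t v) t w = update y t w.
Proof. by apply/funext => u; rewrite /update; case: eqP. Qed.

Lemma updateC y t u v w : t != u ->
  update (update y t v) u w = update (update y u w) t v.
Proof.
move=> tu; apply/funext => r; rewrite /update.
by case: (eqVneq r u) => // ->; rewrite eq_sym (negbTE tu).
Qed.

Lemma resample_idem t h : resample t (resample t h) = resample t h.
Proof.
apply/funext => y; rewrite {1}/resample.
under eq_bigr => s _.
  have -> : resample t h (update y t (Sf_emb s)) = resample t h y.
    by apply: eq_bigr => s' _; rewrite update_update.
  over.
by rewrite -mulr_suml nu_sum mul1r.
Qed.

Lemma resampleC t u h : resample t (resample u h) = resample u (resample t h).
Proof.
have [->//|tu] := eqVneq t u; apply/funext => y; rewrite /resample.
under eq_bigr do rewrite mulr_sumr; under [RHS]eq_bigr do rewrite mulr_sumr.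
rewrite exchange_big/=; apply: eq_bigr => s _; apply: eq_bigr => s' _.
by rewrite updateC// mulrCA.
Qed.

Lemma resample_seqC T t h :
  resample_seq T (resample t h) = resample t (resample_seq T h).
Proof. by elim: T => //= u T IH; rewrite IH resampleC. Qed.

(** Tower property: resamplings commute and are idempotent, so one more at a coordinate of [T]
    changes nothing. *)
Lemma resample_seq_absorb T t h : t \in T ->
  resample_seq T (resample t h) = resample_seq T h.
Proof.
elim: T => //= u T IH; rewrite inE; case: (eqVneq t u) => [<- _|_ /IH ->//].
by rewrite resample_seqC resample_idem.
Qed.

Lemma resample_seq_le T h h' : (forall y, h y <= h' y) ->
  forall y, resample_seq T h y <= resample_seq T h' y.
Proof.
move=> hh'; elim: T => //= t T IH y; apply: ler_sum => s _.
exact: ler_wpM2l.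
Qed.

Lemma resample_seq_cst T (c : R) y : resample_seq T (fun=> c) y = c.
Proof.
elim: T y => //= t T IH y; rewrite /resample.
by under eq_bigr do rewrite IH; rewrite -mulr_suml nu_sum mul1r.
Qed.

Lemma resample_seq_sum T (I : Type) (r : seq I) (c : I -> R) (h : I -> config -> R) y :
  resample_seq T (fun y => \sum_(i <- r) c i * h i y) y =
  \sum_(i <- r) c i * resample_seq T (h i) y.
Proof.
elim: T y => //= t T IH y; rewrite /resample.
transitivity (\sum_(s : Sf Mk) \sum_(i <- r)
    nu s * (c i * resample_seq T (h i) (update y t (Sf_emb s)))).
  by apply: eq_bigr => s _; rewrite IH mulr_sumr.
rewrite exchange_big/=; apply: eq_bigr => i _.
by rewrite mulr_sumr; apply: eq_bigr => s _; rewrite mulrCA.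
Qed.

Section Contraction.
Hypothesis uniform : forall (j : 'I_n) (v : 'I_(absz (Mk j))),
  \sum_(s : Sf Mk | s j == v) nu s = ((absz (Mk j))%:R)^-1.
Context (S : seq Gamma) (Q : set Gamma) (a : 'I_n -> 'I_n * Gamma -> int) (B : nat).
Hypothesis Mk0 : forall m, (0 < absz (Mk m))%N.
Hypothesis QS : forall p, p \in S -> Q p.
Hypothesis QM : forall p q, Q p -> Q q -> Q (p * q)%g.
Hypothesis Q1 : ~ Q 1%g.
Context (theta : R).
Hypothesis theta0 : 0 <= theta.
Local Notation J := (index_pairs n S).
Local Notation N := (fun m => absz (Mk m)).
Hypothesis row_sum : forall m,
  (\sum_(q <- J) absz (a m q))%:R <= theta * (absz (Mk m))%:R.

(** Grouping the elements of [S_f] by their [m]-th digit brings in the [m]-th marginal of [nu]. *)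
Lemma uniform_digit_mean m (phi : nat -> R) :
  \sum_(s : Sf Mk) nu s * phi (s m) =
  (N m)%:R^-1 * \sum_(v < N m) phi v.
Proof.
rewrite (partition_big (fun s : Sf Mk => s m) xpredT)//= mulr_sumr.
apply: eq_bigr => v _; rewrite -(uniform v) mulr_suml.
by apply: eq_bigr => s /eqP ->.
Qed.

(** The contribution [C] of the children does not read the coordinate [t], so it stays fixed while
    the digit at [t] is averaged uniformly; [sum_divn_shift] then removes the floor exactly. *)
Lemma resample_envelope j b t m y :
  resample t (fun y => (envelope S a N B j.+1 b t m y)%:R) y =
  (N m)%:R^-1 * \sum_(q <- J) (absz (a m q))%:R *
     (envelope S a N B j (b (+) (a m q < 0)%R) (t * q.2)%g q.1 y)%:R.
Proof.
pose C := (\sum_(q <- J) absz (a m q) *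
     (envelope S a N B j (b (+) (a m q < 0)%R) (t * q.2)%g q.1 y))%N.
transitivity (\sum_(s : Sf Mk) nu s *
   (fun v => ((reflect_digit N b m v + C) %/ N m)%:R) (s m)).
  apply: eq_bigr => s _; rewrite /= /update eqxx; congr (_ * (_ %/ _)%:R).
  congr addn; rewrite /C big_seq [RHS]big_seq; apply: eq_bigr => q qJ.
  congr muln; apply: eq_envelope => u; case: eqP => // -> tin.
  by have /negP := notin_tree n QS QM Q1 j t (index_pairs_mem qJ).
rewrite (uniform_digit_mean m (fun v => ((reflect_digit N b m v + C) %/ N m)%:R)) -natr_sum; congr (_ * _).
have -> : (\sum_(v < N m) (reflect_digit N b m v + C) %/ N m = C)%N.
  rewrite -[RHS](@sum_divn_shift (N m))// /reflect_digit; case: (b) => //.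
  (* Reversing the order of the digits undoes the reflection. *)
  rewrite [LHS](reindex_inj rev_ord_inj)/=; apply: eq_bigr => v _.
  by congr ((_ + _) %/ _)%N; have := ltn_ord v; lia.
by rewrite natr_sum; apply: eq_bigr => q _; rewrite natrM.
Qed.

(** Averaging the root first costs nothing, since [t] lies in [T], and leaves a combination of
    envelopes of depth [j] with total weight at most [theta]. *)
Lemma resample_seq_envelope j b t m T y : {subset tree n S j t <= T} ->
  resample_seq T (fun y => (envelope S a N B j b t m y)%:R) y <= theta ^+ j * B%:R.
Proof.
elim: j b t m => [|j IH] b t m sub; first by rewrite /= resample_seq_cst mul1r.
rewrite -(@resample_seq_absorb T t); last by apply: sub; rewrite mem_head.
have -> : resample t (fun y => (envelope S a N B j.+1 b t m y)%:R) =
   (fun y => \sum_(q <- J) ((N m)%:R^-1 * (absz (a m q))%:R) *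
     (envelope S a N B j (b (+) (a m q < 0)%R) (t * q.2)%g q.1 y)%:R).
  apply/funext => z; rewrite resample_envelope mulr_sumr.
  by apply: eq_bigr => q _; rewrite mulrA.
rewrite resample_seq_sum.
apply: (@le_trans _ _ (\sum_(q <- J) ((N m)%:R^-1 * (absz (a m q))%:R) * (theta ^+ j * B%:R))).
  rewrite big_seq [leRHS]big_seq; apply: ler_sum => q qJ; rewrite ler_wpM2l ?mulr_ge0//.
  by apply: IH => u uin; apply: sub; rewrite inE; apply/orP; right; apply/flatten_mapP; exists q.
rewrite -mulr_suml -mulr_sumr -natr_sum exprS -[leRHS]mulrA ler_wpM2r ?mulr_ge0 ?exprn_ge0//.
by rewrite mulrC ler_pdivrMr ?ltr0n.
Qed.

End Contraction.
End Resampling.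

(** * Finitely determined events *)

Section FiniteDependence.
Context (Gamma : groupType) (n : nat).
Local Notation config := (Gamma -> 'I_n -> nat).

Definition depends_on (T : seq Gamma) (A : set config) :=
  forall y y' : config, {in T, forall u, y u = y' u} -> A y -> A y'.

Lemma measurable_coordinate (t : Gamma) (v : 'I_n -> nat) :
  measurable ([set y | y t = v] : set (Omega Gamma n)).
Proof. by apply: sub_sigma_algebra; exists t => //; exists v. Qed.

(** Splitting along the value at [t] leaves, in each slice, an event that reads one coordinate
    fewer. *)
Lemma depends_on_measurable (T : seq Gamma) (A : set (Omega Gamma n)) :
  depends_on T A -> measurable A.
Proof.
elim: T A => [|t T IH] A dA.
  have [[y Ay]|nA] := pselect (exists y, A y).
    by rewrite (_ : A = setT)//; apply/seteqP; split=> // y' _; exact: dA Ay.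
  by rewrite (_ : A = set0)//; apply/seteqP; split=> // y Ay; case: nA; exists y.
(* Values are indexed by [{ffun 'I_n -> nat}], a countable type, so that the union is countable. *)
have -> : A = \bigcup_(v : {ffun 'I_n -> nat})
    ([set y : Omega Gamma n | y t = v] `&` [set y | A (update y t v)]).
  apply/seteqP; split=> [y Ay|y [v _ [/= yv]]].
    exists [ffun k => y t k] => //; split; first by apply/funext => k; rewrite /= ffunE.
    apply: dA Ay => u _; rewrite /update; case: eqP => // ->.
    by apply/funext => k; rewrite ffunE.
  apply: dA => u _; rewrite /update; case: eqP => // ->.
  by rewrite yv.
apply: countable_bigcupT_measurable => [|v]; first exact: countableP.
apply: measurableI; first exact: measurable_coordinate.
apply: IH => y y' e; apply: dA => u; rewrite inE /update.
by case: eqP => //= _; exact: e.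
Qed.

End FiniteDependence.

Lemma measure_bigsetU_le d (T : measurableType d) (R : realType)
    (mu : {measure set T -> \bar R}) (I : Type) (r : seq I) (A : I -> set T) :
  (forall i, measurable (A i)) ->
  (mu (\big[setU/set0]_(i <- r) A i) <= \sum_(i <- r) mu (A i))%E.
Proof.
move=> mA; elim: r => [|i r IH]; first by rewrite !big_nil measure0.
rewrite !big_cons; apply: le_trans (measureU2 _ _ _) _ => //.
  exact: bigsetU_measurable.
by rewrite leeD2l.
Qed.

(** * Finitely determined events under the product measure *)

Section ProductMeasure.
Context (R : realType) (Gamma : groupType) (n : nat) (Mk : 'I_n -> int).
Context (nu : Sf Mk -> R) (P : probability (Omega Gamma n) R).
Hypothesis nu_sum : \sum_(s : Sf Mk) nu s = 1.
Hypothesis P_prod : is_product_measure nu P.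
Local Notation config := (Gamma -> 'I_n -> nat).

Definition cylinder (l : seq (Gamma * Sf Mk)) : set (Omega Gamma n) :=
  [set y | forall q, q \in l -> y q.1 = Sf_emb q.2].

Lemma measurable_cylinder l : measurable (cylinder l).
Proof.
apply: (@depends_on_measurable _ _ (unzip1 l)) => y y' e yl q ql.
by rewrite -e ?yl//; exact: map_f.
Qed.

Lemma measure_cylinder l : uniq (unzip1 l) ->
  P (cylinder l) = (\prod_(q <- l) nu q.2)%:E.
Proof.
move=> ul; pose t (i : 'I_(size l)) := (tnth (in_tuple l) i).1.
pose s (i : 'I_(size l)) := (tnth (in_tuple l) i).2.
rewrite big_tnth -(@P_prod _ t s).
  congr (P _); apply/seteqP; split=> y yl.
    by move=> i; apply: yl; exact: mem_tnth.
  by move=> q /(tnthP (in_tuple l))[i ->]; exact: yl.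
move=> i j; have x0 := tnth (in_tuple l) i.
rewrite /t !(tnth_nth x0) /= -!(nth_map _ x0.1)// => /eqP.
by rewrite nth_uniq ?size_map// => /eqP/val_inj.
Qed.

Definition digits_at (t : Gamma) : set (Omega Gamma n) :=
  [set y | forall k, (y t k < absz (Mk k))%N].

Lemma digits_at_cylinders t :
  digits_at t = \bigcup_(s in [set: Sf Mk]) cylinder [:: (t, s)].
Proof.
apply/seteqP; split=> y.
  move=> yt; exists [ffun k => Ordinal (yt k)] => // q; rewrite inE => /eqP -> /=.
  by apply/funext => k; rewrite /Sf_emb ffunE.
by move=> [s _ ys] k; rewrite (ys (t, s) (mem_head _ _)) /Sf_emb.
Qed.

Lemma measurable_digits_at t : measurable (digits_at t).
Proof.
apply: (@depends_on_measurable _ _ [:: t]) => y y' e yt k.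
by rewrite -e ?mem_head.
Qed.

(** [P] lives on all configurations with values in $\mathbb N^n$; its concentration on valid digits
    comes from adding disjoint cylinders, whose masses [nu s] sum to 1. *)
Lemma measure_digits_at t : P (digits_at t) = 1%E.
Proof.
have finS : finite_set [set: Sf Mk] by exact: finite_finset.
rewrite digits_at_cylinders measure_fin_bigcup//; first last.
- by move=> s _; exact: measurable_cylinder.
- move=> s s' _ _ [y [ys ys']]; apply/ffunP => k; apply: val_inj.
  have := ys (t, s) (mem_head _ _); rewrite (ys' (t, s') (mem_head _ _)) /=.
  by move=> /(congr1 (fun v => v k)).
have -> : [set: Sf Mk] = [set` index_enum (Sf Mk)].
  by apply/seteqP; split=> s //= _; exact: mem_index_enum.
rewrite -fsbig_seq ?index_enum_uniq//.
transitivity (\sum_(s : Sf Mk) (nu s)%:E)%E; last by rewrite sumEFin nu_sum.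
apply: eq_bigr => s _.
by have := @measure_cylinder [:: (t, s)] isT; rewrite big_seq1.
Qed.


(** Induction on the coordinates [T] still free: [l] records the values already fixed, and [y] is a
    configuration realising them, at which the resampled indicator is evaluated. *)
Lemma measure_le_resample_aux T l y (A : set (Omega Gamma n)) :
  uniq (unzip1 l ++ T) -> cylinder l y -> depends_on (unzip1 l ++ T) A ->
  (P (A `&` cylinder l) <=
    ((\prod_(q <- l) nu q.2) * resample_seq nu T (fun y => (y \in A)%:R) y)%:E)%E.
Proof.
elim: T l y => [|t T IH] l y /=.
  (* With no free coordinate left, [A] contains the cylinder or misses it. *)
  rewrite cats0 => ul yl dA; case: (boolP (y \in A)) => [yA|/negP yA].
    rewrite mulr1 -measure_cylinder//; apply: le_measure; rewrite ?inE//.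
    - apply: measurableI; last exact: measurable_cylinder.
      exact: depends_on_measurable dA.
    - exact: measurable_cylinder.
  rewrite (_ : _ `&` _ = set0) ?measure0 ?mulr0//.
  apply/seteqP; split=> // z [zA zl]; apply: yA; apply/mem_set.
  by apply: dA zA => u /mapP[q ql ->]; rewrite yl// zl.
move=> ul yl dA; have mA : measurable A by exact: depends_on_measurable dA.
pose D s := A `&` cylinder ((t, s) :: l).
have mD s : measurable (D s) by apply: measurableI => //; exact: measurable_cylinder.
have mC : measurable (~` digits_at t) by apply: measurableC; exact: measurable_digits_at.
(* The event is split by the value at [t]; configurations without valid digits at [t] form a null
   set. *)
apply: (@le_trans _ _ (P (~` digits_at t `|` \big[setU/set0]_(s : Sf Mk) D s))).
  apply: le_measure; rewrite ?inE.
  - by apply: measurableI => //; exact: measurable_cylinder.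
  - by apply: measurableU => //; exact: bigsetU_measurable.
  move=> z [zA zl]; have [zt|zt] := pselect (digits_at t z); last by left.
  right; move: zt; rewrite digits_at_cylinders => -[s _ zs].
  rewrite (bigD1 s)//=; left; split=> // q; rewrite inE => /orP[/eqP ->|/zl//].
  exact/zs/mem_head.
apply: le_trans (measureU2 _ _ _) _ => //; first exact: bigsetU_measurable.
have N0 : (P (~` digits_at t) <= 0)%E.
  by rewrite probability_setC ?measure_digits_at ?subee//; exact: measurable_digits_at.
apply: le_trans (leeD N0 (measure_bigsetU_le P _ mD)) _; rewrite add0e.
rewrite /resample mulr_sumr -sumEFin; apply: lee_sum => s _.
have perm_l : perm_eq (t :: unzip1 l ++ T) (unzip1 l ++ t :: T).
  by rewrite perm_sym perm_catC/= perm_cons perm_catC.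
rewrite mulrA [_ * nu s]mulrC.
have -> : nu s * \prod_(q <- l) nu q.2 = \prod_(q <- (t, s) :: l) nu q.2 by rewrite big_cons.
apply: IH.
- by move: ul; rewrite -(perm_uniq perm_l).
- move=> q; rewrite inE /update => /orP[/eqP -> /=|ql]; first by rewrite eqxx.
  case: eqP => [qt|_]; last exact: yl.
  by move: ul; rewrite -(perm_uniq perm_l)/= mem_cat -qt (map_f fst ql).
- move=> z z' e; apply: dA => u; rewrite -(perm_mem perm_l); exact: e.
Qed.

Lemma measure_le_resample T y (A : set (Omega Gamma n)) :
  uniq T -> depends_on T A ->
  (P A <= (resample_seq nu T (fun y => (y \in A)%:R) y)%:E)%E.
Proof.
move=> uT dA; have := @measure_le_resample_aux T [::] y A uT.
rewrite big_nil mul1r (_ : cylinder [::] = setT) ?setIT; first exact.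
by apply/seteqP; split.
Qed.

End ProductMeasure.

(** * Almost sure injectivity *)

Section MeasurablePhi.
Context (R : realType) (Gamma : groupType) (n : nat).
Local Notation config := (Omega Gamma n).

(** The enumeration [e] turns each sum over the group into a series of nonnegative measurable
    functions. *)
Lemma measurable_lsum (e : nat -> Gamma) (h : Gamma -> config -> R) : bijective e ->
  (forall s, measurable_fun [set: config] (h s)) ->
  measurable_fun [set: config] (fun y => lsum (h^~ y)).
Proof.
move=> [e' eK e'K] mh.
have m_esum (c : Gamma -> config -> R) : (forall s y, 0 <= c s y) ->
    (forall s, measurable_fun [set: config] (c s)) ->
    measurable_fun [set: config] (fun y => fine (\esum_(s in [set: Gamma]) (c s y)%:E)).
  move=> c0 mc; apply: measurableT_comp => //.
  rewrite (_ : (fun y => _) = (fun y => \sum_(i <oo | i \in xpredT) (c (e i) y)%:E)%E).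
    apply: ge0_emeasurable_sum => [k y _ _|k _]; first by rewrite lee_fin.
    exact/measurable_EFinP.
  apply/funext => y; rewrite nneseries_esumT; last by move=> i; rewrite lee_fin.
  apply: reindex_esum; split=> // [i j _ _ /(congr1 e')|s _]; first by rewrite !eK.
  by exists (e' s).
apply: measurable_funB; apply: m_esum.
- by move=> s y; rewrite le_max lexx orbT.
- by move=> s; apply: measurable_maxr.
- by move=> s y; rewrite le_max lexx orbT.
- by move=> s; apply: measurable_maxr => //; exact: measurable_funN.
Qed.

Lemma measurable_phi (f : 'I_n -> 'I_n -> Gamma -> int) (e : nat -> Gamma) t k :
  bijective e -> measurable_fun [set: config] (fun y => phi R f y t k).
Proof.
move=> be; apply: (measurableT_comp (@measurable_frac R)).
apply: measurable_sum => i; apply: (measurable_lsum be) => s.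
apply: measurable_funM => // _ Y mY; rewrite setTI.
apply: (@depends_on_measurable _ _ [:: (t * s^-1)%g]) => y y' ey /=.
by rewrite ey ?mem_head.
Qed.

End MeasurablePhi.

Lemma negligible_countable_bigcup d (T : measurableType d) (R : realType)
    (mu : {measure set T -> \bar R}) (K : countType) (A : K -> set T) :
  (forall k, mu.-negligible (A k)) -> mu.-negligible (\bigcup_k A k).
Proof.
move=> nA; pose A' i := if choice.unpickle i is Some k then A k else set0.
apply: (@negligibleS _ _ _ _ (\bigcup_i A' i)).
  by move=> x [k _ Akx]; exists (choice.pickle k); rewrite // /A' choice.pickleK.
apply: negligible_bigcup => i; rewrite /A'; case: choice.unpickle => //.
exact: negligible_set0.
Qed.

(** * The conull set of injectivity *)

Section Conjugacy.
Context (R : realType) (Gamma : groupType) (n : nat).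
Context (f : 'I_n -> 'I_n -> Gamma -> int) (Mk : 'I_n -> int) (sk : 'I_n -> Gamma).
Context (g : 'I_n -> 'I_n -> Gamma -> int) (S : seq Gamma) (Q : set Gamma).
Context (nu : Sf Mk -> R) (P : probability (Omega Gamma n) R).
Hypothesis lop : shifted_lopsided f Mk sk g S Q.
Hypothesis nu_ge0 : forall s, 0 <= nu s.
Hypothesis nu_sum : \sum_(s : Sf Mk) nu s = 1.
Hypothesis uniform : forall (j : 'I_n) (v : 'I_(absz (Mk j))),
  \sum_(s : Sf Mk | s j == v) nu s = ((absz (Mk j))%:R)^-1.
Hypothesis P_prod : is_product_measure nu P.

Local Notation J := (index_pairs n S).
Local Notation N := (fun m => absz (Mk m)).

(* The signs of the diagonal are absorbed here so that the envelopes divide by the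
   positive numbers [|M_m|]. *)
Definition signed_coef (m : 'I_n) (q : 'I_n * Gamma) : int :=
  off_diag sk g m q * sgz (Mk q.1).

Local Notation env := (envelope S signed_coef N).

Lemma Mk_sgz2 m : sgz (Mk m) * sgz (Mk m) = 1.
Proof. by rewrite mulz_sg -absz_eq0 -lt0n (Mk_gt0 lop). Qed.

Lemma absz_signed_coef m q : absz (signed_coef m q) = absz (off_diag sk g m q).
Proof.
by rewrite /signed_coef abszM absz_sg -absz_eq0 -lt0n (Mk_gt0 lop) muln1.
Qed.

Lemma depends_on_envelope B j b t m :
  depends_on (undup (tree n S j t)) [set y | env B j b t m y != 0%N].
Proof.
move=> y y' e; have ee : env B j b t m y = env B j b t m y'.
  by apply: eq_envelope => u uin; apply: e; rewrite mem_undup.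
by rewrite /= ee.
Qed.

Definition never_zero B b t m : set (Omega Gamma n) :=
  \bigcap_j [set y | env B j b t m y != 0%N].

Lemma measurable_never_zero B b t m : measurable (never_zero B b t m).
Proof.
apply: bigcapT_measurable => j.
exact: depends_on_measurable (@depends_on_envelope B j b t m).
Qed.

(** Markov's inequality: a nonzero natural number is at least 1, so the envelope at depth [j] is
    nonzero with probability at most its mean, hence at most [theta ^+ j * B], which tends to 0. *)
Lemma negligible_never_zero B b t m : P.-negligible (never_zero B b t m).
Proof.
have [theta [/andP[theta0 theta1] row_sum]] := contraction_constant R lop.
apply/negligibleP; first exact: measurable_never_zero.
have le_geo j : (P (never_zero B b t m) <= (theta ^+ j * B%:R)%:E)%E.
  pose E : set (Omega Gamma n) := [set y | env B j b t m y != 0%N].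
  have dE := @depends_on_envelope B j b t m.
  apply: (@le_trans _ _ (P E)).
    apply: le_measure; rewrite ?inE.
    - exact: measurable_never_zero.
    - exact: depends_on_measurable dE.
    - by move=> y; apply.
  apply: le_trans (measure_le_resample nu_sum P_prod (fun _ _ => 0%N) (undup_uniq _) dE) _.
  rewrite lee_fin.
  have rs m' : (\sum_(q <- J) absz (signed_coef m' q))%:R <= theta * (absz (Mk m'))%:R.
    by under eq_bigr do rewrite absz_signed_coef.
  have sub : {subset tree n S j t <= undup (tree n S j t)} by move=> u; rewrite mem_undup.
  apply: le_trans (resample_seq_envelope nu_sum uniform B (Mk_gt0 lop)
    (shifted_sub lop) (shifted_mul lop) (shifted_one lop) theta0 rs b m (fun _ _ => 0%N) sub).
  apply: resample_seq_le => // y; rewrite ler_nat.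
  by case: (boolP (y \in E)) => // /set_mem; rewrite /E /= lt0n.
suff h : (P (never_zero B b t m) <= 0)%E by apply/eqP; rewrite eq_le h measure_ge0.
have Pfin : P (never_zero B b t m) \is a fin_num.
  by apply: fin_num_measure; exact: measurable_never_zero.
rewrite -(fineK Pfin) lee_fin.
have cv : (fun j => theta ^+ j * B%:R) @ \oo --> 0 * (B%:R : R).
  by apply: cvgM; [apply: cvg_expr; rewrite ger0_norm|exact: cvg_cst].
rewrite -(mul0r (B%:R : R)) -(cvg_lim (@Rhausdorff R) cv).
apply: limr_ge; first by apply/cvg_ex; eexists; exact: cv.
by near=> j; rewrite -lee_fin fineK.
Unshelve. all: by end_near. Qed.

(** All starting bounds [B] are included, since [phi_eq_integral] supplies a bound without an
    explicit value; the conditions remain countable in number when the group is. *)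
Definition injectivity_set : set (Omega Gamma n) :=
  SfG Mk `&` [set y | forall B b t m, exists j, env B j b t m y = 0%N].

Lemma injectivity_set_setC (e : nat -> Gamma) : bijective e ->
  ~` injectivity_set = \bigcup_(i : nat) ~` digits_at Mk (e i) `|`
    \bigcup_(k : nat * bool * nat * 'I_n) never_zero k.1.1.1 k.1.1.2 (e k.1.2) k.2.
Proof.
move=> [e' _ e'K]; apply/seteqP; split=> y.
  move=> nA; apply: contrapT => /not_orP[n1 n2]; apply: nA; split.
    move=> t; apply: contrapT => nt; apply: n1; exists (e' t) => //=.
    by rewrite e'K.
  move=> B b t m; apply: contrapT => nex; apply: n2.
  exists (B, b, e' t, m) => //= j _; rewrite /= e'K; apply/eqP => e0.
  by apply: nex; exists j.
move=> [[i _ ni]|[[[[B b] i] m] _ /= nz]] [yS yz].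
  by apply: ni => k; exact: yS.
by have [j e0] := yz B b (e i) m; have := nz j I; rewrite /= e0.
Qed.

Lemma measurable_injectivity_set (e : nat -> Gamma) : bijective e ->
  measurable injectivity_set.
Proof.
move=> be; rewrite -[injectivity_set]setCK; apply: measurableC.
rewrite (injectivity_set_setC be); apply: measurableU.
  apply: bigcupT_measurable => i; apply: measurableC; exact: measurable_digits_at.
apply: countable_bigcupT_measurable => [|k]; first exact: countableP.
exact: measurable_never_zero.
Qed.

Lemma negligible_injectivity_setC (e : nat -> Gamma) : bijective e ->
  P.-negligible (~` injectivity_set).
Proof.
move=> be; rewrite (injectivity_set_setC be); apply: negligibleU.
  apply: negligible_bigcup => i; apply/negligibleP.
    by apply: measurableC; exact: measurable_digits_at.
  suff : P (~` digits_at Mk (e i)) = 0%E by [].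
  by rewrite probability_setC ?(measure_digits_at nu_sum P_prod) ?subee//;
    exact: measurable_digits_at.
apply: negligible_countable_bigcup => k; exact: negligible_never_zero.
Qed.

(** The envelopes are computed from [y] alone, so placing [y] in the good set controls its whole
    fibre in $S_f^\Gamma$. *)
Lemma phi_injective y y' : injectivity_set y -> SfG Mk y' ->
  phi R f y' = phi R f y -> y' = y.
Proof.
move=> [yS yz] y'S e; have [z [[B zB] zE]] := phi_eq_integral lop yS y'S e.
pose x t m := sgz (Mk m) * z (t * sk m)%g m.
have xB t m : (absz (x t m) <= B)%N.
  by rewrite /x abszM absz_sg -absz_eq0 -lt0n (Mk_gt0 lop) mul1n.
have xE t m : (y t m)%:Z - (y' t m)%:Z =
    (N m)%:Z * x t m - \sum_(q <- J) signed_coef m q * x (t * q.2)%g q.1.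
  rewrite zE /x mulrA [_%:Z * sgz _]mulrC -intEsg; congr (_ - _).
  apply: eq_bigr => q _; rewrite /signed_coef -!mulrA; congr (_ * _).
  by rewrite [RHS]mulrA Mk_sgz2 mul1r mulgA.
have env_le := envelopeP (Mk_gt0 lop) y'S yS xB xE.
have x0 t m : x t m = 0.
  (* The two vanishing envelopes, possibly at different depths, bound [x] and [- x] by 0. *)
  have [j1 e1] := yz B false t m; have [j2 e2] := yz B true t m.
  have := env_le j1 false t m; have := env_le j2 true t m.
  by rewrite e1 e2 expr0 expr1 mul1r mulN1r; lia.
apply/funext => t; apply/funext => m; have := xE t m.
rewrite x0 mulr0 big1; last by move=> q _; rewrite x0 mulr0.
by lia.
Qed.

Lemma injectivity_set_shift (s : Gamma) y :
  injectivity_set y -> injectivity_set (gshift s y).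
Proof.
move=> [yS yz]; split=> [t k|B b t m]; first exact: yS.
by have [j e0] := yz B b (s^-1 * t)%g m; exists j; rewrite envelope_shift.
Qed.

End Conjugacy.

Theorem theorem1p1 (R : realType) (Gamma : groupType) (n : nat)
  (f : 'I_n -> 'I_n -> Gamma -> int)
  (Mk : 'I_n -> int) (sk : 'I_n -> Gamma) (g : 'I_n -> 'I_n -> Gamma -> int)
  (nu : Sf Mk -> R) (P : probability (Omega Gamma n) R) :
  (exists e : nat -> Gamma, bijective e) ->
  pos_row_lopsided f Mk sk g ->
  (forall s, 0 <= nu s) -> \sum_(s : Sf Mk) nu s = 1 ->
  (forall (j : 'I_n) (a : 'I_(absz (Mk j))),
      \sum_(s : Sf Mk | s j == a) nu s = ((absz (Mk j))%:R)^-1) ->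
  is_product_measure nu P ->
  P.-negligible [set y | SfG Mk y /\
      exists y', [/\ SfG Mk y', y' <> y & phi R f y' = phi R f y]] /\
  (* consequently: phi_f restricted to S_f^Gamma is a measure conjugacy *)
  [/\ (forall y, SfG Mk y -> Xf f (phi R f y)),
      (forall (s : Gamma) y, SfG Mk y -> phi R f (gshift s y) = gshift s (phi R f y)),
      (forall t k, measurable_fun (SfG Mk : set (Omega Gamma n)) (fun y => phi R f y t k)) &
      exists A : set (Omega Gamma n),
        [/\ measurable A, A `<=` SfG Mk, P A = 1%E,
            (forall (s : Gamma) y, A y -> A (gshift s y)) &
            (forall y1 y2, A y1 -> A y2 -> phi R f y1 = phi R f y2 -> y1 = y2)]].
Proof.
move=> [e be] /pos_row_lopsided_shifted[S [Q lop]] nu0 nu1 unif Pprod.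
pose A := injectivity_set Mk sk g S.
have mA : measurable A := measurable_injectivity_set Mk sk g S be.
have nA : P.-negligible (~` A) := negligible_injectivity_setC lop nu0 nu1 unif Pprod be.
split.
  (* A point of [A] is alone in its fibre, so the exceptional set lies in the complement of [A]. *)
  apply: negligibleS nA => y [yS [y' [y'S ne eq_phi]]] yA.
  by apply: ne; exact: (@phi_injective R _ _ _ _ _ _ _ _ lop y y' yA).
split.
- by move=> y; exact: (@phi_Xf R _ _ _ _ _ _ _ _ lop y).
- by move=> s y _; exact: phi_equivariant.
- by move=> t k; apply: measurable_funTS; exact: measurable_phi be.
exists A; split => //.
- by move=> y [].
- have P0 : P (~` A) = 0%E by apply/negligibleP => //; exact: measurableC.
  by rewrite -[A]setCK probability_setC ?P0 ?sube0//; exact: measurableC.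
- by move=> s y; exact: injectivity_set_shift.
- by move=> y1 y2 A1 A2 ep; apply: (@phi_injective R _ _ _ _ _ _ _ _ lop y2 y1 A2) => //; case: A1.
Qed.
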